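(* Let $\mathfrak g$ be a complex semi-simple Lie algebra with adjoint group $\mathbf G$, let $x\in\mathfrak g$ and let $x=s+e$ be its Jordan-Chevalley decomposition ($s$ semi-simple, $e$ nilpotent, $[s,e]=0$). Let $(h,e,f)$ be an $\mathfrak{sl}_2$-triple with $[s,h]=[s,f]=0$. Let $\mathfrak n_s:=\mathfrak g(s)^\perp$, let $\mathfrak n_e\in\mathcal N_{s,h}$ and let $\mathfrak n:=\mathfrak n_s\oplus\mathfrak n_e$. Let $N_x:=x+\mathfrak n^\perp$, which is a transverse slice to $\mathbf G\cdot x$ at $x$. Then the transverse Poisson structure on $N_x$ is polynomial and is quasi-homogeneous of quasi-degree $-2$, in terms of the linear coordinates $q_1,\dots,q_k$ on $N_x$ with quasi-degrees $\varpi(q_i)=n_i+2$.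
   Context: $\langle\cdot|\cdot\rangle$ is the Killing form of $\mathfrak g$ and $\perp$ the orthogonal complement with respect to it. For $y\in\mathfrak g$, $\mathfrak g(y)$ is the centralizer of $y$ in $\mathfrak g$; $\mathfrak g(x)=\mathfrak g(s)\cap\mathfrak g(e)$. An $\mathfrak{sl}_2$-triple $(h,e,f)$ satisfies $[h,e]=2e$, $[h,f]=-2f$, $[e,f]=h$; one with $[s,h]=[s,f]=0$ always exists and lies in the reductive Lie algebra $\mathfrak g(s)$. $\mathcal N_{s,h}$ is the set of all $\operatorname{ad}_h$-invariant subspaces of $\mathfrak g(s)$ complementary to $\mathfrak g(x)$ in $\mathfrak g(s)$. As a module over the subalgebra generated by $h,e,f$, $\mathfrak g(s)$ decomposes as $\bigoplus_{j=1}^kV_{n_j}$, with $V_{n_j}$ simple of highest weight $n_j$ and $k=\dim\mathfrak g(x)$. Let $(Z_1,\dots,Z_k)$ be a basis of $\mathfrak g(x)$ with $Z_i$ a highest weight vector of weight $n_i$. The coordinates on $N_x$ are $q_i(y):=\langle y-x|Z_i\rangle$. The Lie-Poisson structure on $\mathfrak g$ is $\{F,G\}(y):=\langle y|[dF(y),dG(y)]\rangle$, where differentials are viewed as elements of $\mathfrak g\cong\mathfrak g^*$ via the Killing form. With $(X_1,\dots,X_{2r})$ a basis of $\mathfrak n$, the transverse Poisson structure on $N_x$ is given by Dirac reduction: its Poisson matrix in the coordinates $q_1,\dots,q_k$ at $n\in N_x$ is $A(n)+B(n)C(n)^{-1}B(n)^\top$, where $A_{ij}(n)=\langle n|[Z_i,Z_j]\rangle$,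 $B_{im}(n)=\langle n|[Z_i,X_m]\rangle$, $C_{lm}(n)=\langle n|[X_l,X_m]\rangle$ ($C$ is invertible near $x$). Quasi-homogeneity: given non-negative integers $\nu=(\nu_1,\dots,\nu_k)$, a polynomial $P\in\mathbb C[q_1,\dots,q_k]$ is quasi-homogeneous of quasi-degree $\kappa$ (relative to $\nu$) if $P(t^{\nu_1}q_1,\dots,t^{\nu_k}q_k)=t^\kappa P(q_1,\dots,q_k)$ for all $t\in\mathbb C^*$. A polynomial Poisson structure is quasi-homogeneous of quasi-degree $\kappa\in\mathbb Z$ (relative to $\nu$) if, for all $i,j$, $\{q_i,q_j\}$ is quasi-homogeneous of quasi-degree $\nu_i+\nu_j+\kappa$ (the zero polynomial being quasi-homogeneous of every quasi-degree). *)

(* Defs.v *)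
From HB Require Import structures.
From mathcomp Require Import all_boot all_order all_algebra.
From mathcomp Require Import reals.
From mathcomp Require Export complex mpoly.

Set Implicit Arguments.
Unset Strict Implicit.
Unset Printing Implicit Defensive.

Import passmx Order.TTheory GRing.Theory Num.Theory.
Local Open Scope ring_scope.

HB.mixin Record isLieAlgebra (K : fieldType) L of Vector K L := {
  lie : L -> L -> L;
  lieDl : forall (a : K) (x y z : L),
    lie (a *: x + y) z = a *: lie x z + lie y z;
  lieDr : forall (a : K) (x y z : L),
    lie z (a *: x + y) = a *: lie z x + lie z y;
  liexx : forall x : L, lie x x = 0;
  lie_jacobi : forall x y z : L,
    lie x (lie y z) + lie y (lie z x) + lie z (lie x y) = 0
}.

#[short(type="lieAlgType")]
HB.structure Definition LieAlgebra (K : fieldType) :=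
  { L of isLieAlgebra K L & Vector K L }.

Notation "[ 'lie' x , y ]" := (lie x y)
  (at level 0, x at level 99, y at level 99, format "[ 'lie'  x ,  y ]")
  : ring_scope.

Section Lie.
Variables (K : fieldType) (g : lieAlgType K).
Implicit Types (x y z s h e f v : g) (U V I : {vspace g}).

Fact lie_is_linear x : linear (lie x : g -> g).
Proof. by move=> a y z; rewrite lieDr. Qed.
HB.instance Definition _ x :=
  GRing.isLinear.Build K g g _ (lie x : g -> g) (lie_is_linear x).

Definition ad x : 'End(g) := linfun (lie x : g -> g).

Lemma adE x y : ad x y = [lie x, y].
Proof. by rewrite lfunE. Qed.

Definition centralizer y : {vspace g} := lker (ad y).

Definition killing x y : K :=
  \tr (mxof (vbasis {:g}) (vbasis {:g}) (ad x \o ad y)%VF).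

Fact killing_is_linear x : linear (killing x : g -> K^o).
Proof.
move=> a y z; rewrite /killing.
have -> : (ad x \o ad (a *: y + z) =
           a *: (ad x \o ad y) + (ad x \o ad z))%VF.
  apply/lfunP => v; rewrite add_lfunE scale_lfunE !comp_lfunE !adE lieDl.
  by rewrite linearP.
by rewrite !linearP.
Qed.
HB.instance Definition _ x :=
  GRing.isLinear.Build K g K^o _ (killing x : g -> K^o) (killing_is_linear x).

Lemma killingC x y : killing x y = killing y x.
Proof.
have mxof_comp (a b : 'End(g)) :
    mxof (vbasis {:g}) (vbasis {:g}) (a \o b)%VF =
    mxof (vbasis {:g}) (vbasis {:g}) b *m mxof (vbasis {:g}) (vbasis {:g}) a.
  by apply: mxof_comp; apply: vbasisP.
by rewrite /killing !mxof_comp mxtrace_mulC.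
Qed.

Definition kperp U : {vspace g} :=
  (\bigcap_(u <- vbasis U) lker (linfun (killing u : g -> K^o)))%VS.

Lemma kperpP U y :
  reflect (forall u, u \in U -> killing u y = 0) (y \in kperp U).
Proof.
have memP (r : seq g) :
    (y \in \bigcap_(u <- r) lker (linfun (killing u : g -> K^o)))%VS
    = all (fun u => killing u y == 0) r.
  elim: r => [|u r IH]; first by rewrite big_nil memvf.
  by rewrite big_cons memv_cap IH memv_ker lfunE.
rewrite /kperp memP; apply: (iffP allP) => [H u uU|H u uU].
  rewrite killingC (coord_vbasis uU) linear_sum /= big1 // => i _.
  rewrite linearZ /= killingC.
  by rewrite (eqP (H _ (mem_nth 0 _))) ?scaler0 // size_tuple.
by apply/eqP/H/vbasis_mem.
Qed.

Definition lie_span U V : {vspace g} :=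
  <<[seq [lie u, v] | u <- vbasis U, v <- vbasis V]>>%VS.

Definition lie_ideal I : Prop :=
  forall x y, y \in I -> [lie x, y] \in I.

Definition solvable_subspace I : Prop :=
  exists d : nat, iter d (fun U => lie_span U U) I = 0%VS.

(* The radical is zero. *)
Definition semisimple_lie : Prop :=
  forall I, lie_ideal I -> solvable_subspace I -> I = 0%VS.

(* ad_s is diagonalizable; this is semi-simplicity of s when K is
   algebraically closed. *)
Definition semisimple_elt s : Prop :=
  exists2 b : seq g, basis_of {:g} b
    & forall v, v \in b -> exists a : K, [lie s, v] = a *: v.

Definition nilpotent_elt e : Prop :=
  exists N : nat, forall y, iter N (lie e) y = 0.

Definition jordan_chevalley x s e : Prop :=
  [/\ x = s + e, semisimple_elt s, nilpotent_elt e & [lie s, e] = 0].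

Definition sl2_triple h e f : Prop :=
  [/\ [lie h, e] = 2 *: e, [lie h, f] = - 2 *: f & [lie e, f] = h].

Definition highest_weight_vector h e (m : nat) v : Prop :=
  [/\ v != 0, [lie e, v] = 0 & [lie h, v] = m%:R *: v].

(* The ad_h-invariant complements of g(x) in g(s). *)
Definition calN s h x U : Prop :=
  [/\ (U <= centralizer s)%VS,
      (ad h @: U <= U)%VS,
      (U + centralizer x)%VS = centralizer s
    & directv (U + centralizer x)].

(* The tangent space [x, g] at x to the orbit of x under the adjoint group. *)
Definition orbit_tangent x : {vspace g} := limg (ad x).

Definition slice x U : pred g := [pred y | y - x \in kperp U].

Definition slice_coord k x (Z : k.-tuple g) y : 'I_k -> K :=
  fun i => killing (y - x) (tnth Z i).

(* The Lie-Poisson brackets at y of the linear functions <.|U_i> and <.|V_j>. *)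
Definition lie_poisson_mx k m (U : k.-tuple g) (V : m.-tuple g) y :
    'M[K]_(k, m) :=
  \matrix_(i, j) killing y [lie tnth U i, tnth V j].

(* Dirac reduction: the brackets at y of the coordinates attached to Z, where X
   is a basis of the subspace n directing the slice x + kperp n. Meaningful only
   where lie_poisson_mx X X y is invertible, since invmx is the identity on
   singular matrices. *)
Definition transverse_poisson_mx k m (Z : k.-tuple g) (X : m.-tuple g) y :
    'M[K]_k :=
  lie_poisson_mx Z Z y
  + lie_poisson_mx Z X y *m invmx (lie_poisson_mx X X y)
    *m (lie_poisson_mx Z X y)^T.

End Lie.

Definition quasi_homogeneous (K : fieldType) k (nu : 'I_k -> nat) (kappa : int)
    (P : {mpoly K[k]}) : Prop :=
  forall t : K, t != 0 -> forall q : 'I_k -> K,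
    P.@[fun i => t ^+ nu i * q i] = t ^ kappa * P.@[q].

Definition quasi_homogeneous_poisson (K : fieldType) k (nu : 'I_k -> nat)
    (kappa : int) (P : 'M[{mpoly K[k]}]_k) : Prop :=
  forall i j, quasi_homogeneous nu ((nu i)%:Z + (nu j)%:Z + kappa) (P i j).

(* Main.v *)
From HB Require Import structures.
Require Import Defs.
From mathcomp Require Import all_boot all_order all_algebra reals ring zify.

(** The statement splits into a linear part (the decomposition of g, the
    transversality of the slice, the invertibility of the bracket matrix of n
    at x), which is duality for the Killing form, and a graded part, which is a
    count of weights for ad h.

    Linear part.  By Cartan's criterion the Killing form is nondegenerate
    (killing_nondegenerate).  Being invariant, it turns ker (ad y) into the
    orthogonal of im (ad y), so that [x, g] is the orthogonal of g(x).
    Semisimplicity of s gives g = g(s)^perp + g(s), a direct sum, and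
    g(x) = g(s) meet g(e); hence n is a complement of g(x), the orthogonals of
    n and of g(x) are complementary, and the form <x|[u,v]> = <[x,u]|v>, whose
    kernel is g(x), is nondegenerate on n.

    Graded part.  A point y of the slice lies in g(s), hence for u in g(s) and
    v in g(s)^perp the bracket <y|[u,v]> = <[y,u]|v> vanishes: n_s decouples
    from n_e and from the Z_i, and the Dirac reduction along n equals the Dirac
    reduction along n_e.  The basis-free form of Dirac reduction makes this
    immediate: the (i,j) entry is <y|[Z_i - u, Z_j]> where u in n is any vector
    such that <y|[u - Z_i, v]> = 0 for all v in n (transverse_poisson_mxE).

    Next n_e has a basis X_l of generalized eigenvectors of ad h with integer
    eigenvalues a_l, because raising an eigenvector by ad e ends in g(x), where
    the weights are the n_i.  The slice is parametrized by x + sum q_i Zd_i,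
    where Zd_i is the basis of n^perp dual to Z_i; it has weight - n_i.  Since
    the Killing form pairs weight a with weight - a only, and e has weight 2,
    dilating q_i by t^(n_i+2) multiplies <y|[u,v]> by t^(a+b+2) when u and v in
    g(s) have weights a and b; the summand s of y contributes nothing.  In
    matrix form A, B, C become N A N, N B D, D C D with diagonal N =
    (t^(n_i+1)) and D = (t^(a_l+1)), hence A + B C^-1 B^T becomes
    N (A + B C^-1 B^T) N, which is quasi-homogeneity of quasi-degree -2.
    Finally det C is multiplied by (det D)^2 under every dilation; its value
    at q = 0 is nonzero and fixed by dilations, thus (det D)^2 = 1 and det C
    is invariant.  The quasi-degrees n_i + 2 being positive, det C is constant,
    so that C^-1 = (det C)^-1 adj C is polynomial.

    Cartan's criterion is reached as follows.  The derived series of the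
    radical of the Killing form ends in a perfect subalgebra J.  For y in J let
    D act on each generalized eigenspace of ad y by the complex conjugate of
    the eigenvalue; D is a derivation, so tr (D ad [u,v]) = - <D v|u> = 0 for u
    and v in J, and tr (D ad y) = 0.  That trace is the sum of the squared
    moduli of the eigenvalues of ad y, so ad y is nilpotent; Engel's theorem
    forces J = 0. *)

Set Implicit Arguments.
Unset Strict Implicit.
Unset Printing Implicit Defensive.
Import passmx Order.TTheory GRing.Theory Num.Theory.
Local Open Scope ring_scope.

(** * Generalized eigenvectors *)

Lemma free_subseq (K : fieldType) (V : vectType K) (s : seq V) :
  exists2 t : seq V, {subset t <= s} & free t /\ (<<t>> = <<s>>)%VS.
Proof.
elim: s => [|v s [t ts [t_free tE]]]; first by exists [::]; rewrite ?nil_free.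
have [vt|vt] := boolP (v \in <<t>>%VS).
  exists t => [u /ts us|]; first by rewrite inE us orbT.
  split=> //; rewrite span_cons -tE; apply/eqP; rewrite eqEsubv addvSr subv_add.
  by rewrite -memvE vt subvv.
exists (v :: t) => [u|]; last by rewrite free_cons vt t_free !span_cons tE.
by rewrite !inE => /orP[->//|/ts ->]; rewrite orbT.
Qed.

Lemma span_ind (K : fieldType) (V : vectType K) (X : seq V) (P : V -> Prop) :
  P 0 -> (forall c u v, P u -> P v -> P (c *: u + v)) ->
  (forall u, u \in X -> P u) -> forall v, v \in <<X>>%VS -> P v.
Proof.
move=> P0 PD PX v vX; rewrite (coord_span (X := in_tuple X) vX).
elim/big_rec: _ => // i u _ Pu; apply: PD => //.
exact: PX (mem_nth 0 (ltn_ord i)).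
Qed.

Lemma iter_lfun0 (K : fieldType) (V : vectType K) (T : 'End(V)) N :
  iter N T 0 = 0.
Proof. by elim: N => //= N ->; rewrite linear0. Qed.

Lemma iter_lfun_linear (K : fieldType) (V : vectType K) (T : 'End(V)) N c u v :
  iter N T (c *: u + v) = c *: iter N T u + iter N T v.
Proof. by elim: N => //= N ->; rewrite linearP. Qed.

Lemma iter_lfun_leq (K : fieldType) (V : vectType K) (T : 'End(V)) M N v :
  (M <= N)%N -> iter M T v = 0 -> iter N T v = 0.
Proof. by move=> /subnK <- Mv; rewrite iterD Mv iter_lfun0. Qed.

Lemma iter_last (T : Type) (f : T -> T) (Q : pred T) N v :
  ~~ Q v -> Q (iter N f v) ->
  exists2 j, ~~ Q (iter j f v) & Q (iter j.+1 f v).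
Proof.
elim: N => [|N IH] Qv; first by move=> /= Qv'; rewrite Qv' in Qv.
have [/(IH Qv)//|QN QN1] := boolP (Q (iter N f v)).
by exists N.
Qed.

Section GenEigen.
Variables (K : fieldType) (V : vectType K).
Implicit Types (F : 'End(V)) (a b c : K) (u v w : V) (W : {vspace V}).

Definition eigen_shift F a : 'End(V) := (F - a *: \1)%VF.

Lemma eigen_shiftE F a v : eigen_shift F a v = F v - a *: v.
Proof. by rewrite add_lfunE opp_lfunE scale_lfunE id_lfunE. Qed.

Definition gen_eigen F a v := exists N, iter N (eigen_shift F a) v = 0.

Lemma gen_eigen0 F a : gen_eigen F a 0.
Proof. by exists 0%N. Qed.

Lemma gen_eigenP F a c u v :
  gen_eigen F a u -> gen_eigen F a v -> gen_eigen F a (c *: u + v).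
Proof.
move=> [M Mu] [N Nv]; exists (maxn M N); rewrite iter_lfun_linear.
rewrite (iter_lfun_leq (leq_maxl M N) Mu) (iter_lfun_leq (leq_maxr M N) Nv).
by rewrite scaler0 addr0.
Qed.

Lemma gen_eigenD F a u v :
  gen_eigen F a u -> gen_eigen F a v -> gen_eigen F a (u + v).
Proof. by move=> Hu Hv; rewrite -[u]scale1r; apply: gen_eigenP. Qed.

Lemma gen_eigen_shift F a v :
  gen_eigen F a (eigen_shift F a v) -> gen_eigen F a v.
Proof. by move=> [N Nv]; exists N.+1; rewrite iterSr. Qed.

Lemma eigen_gen_eigen F a v : F v = a *: v -> gen_eigen F a v.
Proof. by move=> Fv; exists 1%N; rewrite /= eigen_shiftE Fv subrr. Qed.

Definition stable F W := forall v, v \in W -> F v \in W.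

Lemma stable_shift F a W v : stable F W -> v \in W -> eigen_shift F a v \in W.
Proof. by move=> FW vW; rewrite eigen_shiftE memvB ?memvZ ?FW. Qed.

(** On the generalized eigenspace of b, F - a is the sum of the invertible
    scalar b - a and the nilpotent F - b; the preimage is found by induction on
    the order of nilpotency, within any F-stable subspace. *)
Lemma gen_eigen_solve F W a b u : stable F W -> b != a ->
  u \in W -> gen_eigen F b u ->
  exists w, [/\ w \in W, gen_eigen F b w & eigen_shift F a w = u].
Proof.
move=> FW ba uW [N]; elim: N u uW => [|N IH] u uW.
  move=> /= ->; exists 0; rewrite mem0v linear0; split=> //.
  exact: gen_eigen0.
rewrite iterSr => /IH [|w [wW wb wE]]; first exact: stable_shift.
exists ((b - a)^-1 *: (u - w)).
have uwb : gen_eigen F b (u - w).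
  have ub : gen_eigen F b u.
    apply: gen_eigen_shift; rewrite -wE eigen_shiftE.
    have -> : F w - a *: w = (b - a) *: w + eigen_shift F b w.
      by rewrite eigen_shiftE scalerBl [RHS]addrC addrA subrK.
    apply: gen_eigenP => //; case: wb => M Mw; exists M.
    by rewrite -iterSr iterS Mw linear0.
  by rewrite addrC -scaleN1r; apply: gen_eigenP.
split; first by rewrite memvZ ?memvB.
  by rewrite -[X in gen_eigen F b X]addr0; apply: gen_eigenP (gen_eigen0 F b).
rewrite linearZ /= [eigen_shift F a (u - w)]linearB /= wE !eigen_shiftE.
have -> : F u - a *: u - (F u - b *: u) = (b - a) *: u.
  by rewrite opprB addrC addrA subrK -scalerBl.
by rewrite scalerA mulVf ?scale1r // subr_eq0.
Qed.

(** An inductive predicate rather than a sum of eigenspaces, so that properties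
    closed under addition are transported to sums by elimination. *)
Inductive gen_eigen_sum F W : V -> Prop :=
| GenEigenSum0 : gen_eigen_sum F W 0
| GenEigenSumD a u v of u \in W & gen_eigen F a u & gen_eigen_sum F W v :
    gen_eigen_sum F W (u + v).

Lemma gen_eigen_sum_mem F W v : gen_eigen_sum F W v -> v \in W.
Proof.
by elim=> [|a u {}v uW _ _ vW]; [exact: mem0v | exact: memvD].
Qed.

(** Decompose (F - a) v: the components for b <> a have preimages under F - a by
    gen_eigen_solve, and after subtracting these preimages from v the rest is
    sent by F - a into the generalized eigenspace of a. *)
Lemma gen_eigen_sum_unshift F W a v : stable F W -> v \in W ->
  gen_eigen_sum F W (eigen_shift F a v) -> gen_eigen_sum F W v.
Proof.
move=> FW vW; set u := eigen_shift F a v => us.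
suff [w [z [ws zW za uE]]] : exists w z,
    [/\ gen_eigen_sum F W w, z \in W, gen_eigen F a z
      & u = eigen_shift F a w + z].
  rewrite -[v](subrK w); apply: (GenEigenSumD (a := a)) => //.
    by rewrite memvB // (gen_eigen_sum_mem ws).
  apply: gen_eigen_shift; rewrite linearB /= [eigen_shift F a v]uE addrAC.
  by rewrite subrr add0r.
elim: us => {u} [|b u u' uW ub _ [w [z [ws zW za ->]]]].
  exists 0, 0; split; rewrite ?mem0v ?linear0 ?addr0 //.
    exact: GenEigenSum0.
  exact: gen_eigen0.
have [ba|ba] := eqVneq b a.
  exists w, (u + z); split=> //; first exact: memvD.
    by apply: gen_eigenD => //; rewrite -ba.
  by rewrite addrCA.
have [y [yW yb <-]] := gen_eigen_solve FW ba uW ub.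
exists (y + w), z; split=> //; first exact: GenEigenSumD yW yb ws.
by rewrite linearD addrA.
Qed.

End GenEigen.

Section ClosedGenEigen.
Variables (K : closedFieldType) (V : vectType K).
Implicit Types (F : 'End(V)) (a b c : K) (u v w : V) (W : {vspace V}).

(** Cayley-Hamilton, the characteristic polynomial being split.  The factors are
    composed one after the other so that gen_eigen_sum_unshift can peel them
    off. *)
Lemma annihilating_shifts F :
  exists s : seq K, forall v, foldl (fun u a => eigen_shift F a u) v s = 0.
Proof.
pose b := vbasis {:V}; have b_basis : basis_of {:V} b := vbasisP _.
pose M := mxof b b F.
suff [s sE] : exists s : seq K, forall u : 'rV[K]_(\dim {:V}),
    foldl (fun (u : 'rV_(\dim {:V})) a => u *m M - a *: u) u s = 0.
  exists s => v; apply: (can_inj (rVofK b_basis)).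
  rewrite [RHS]linear0 -[RHS](sE (rVof b v)).
  elim: s {sE} v => //= a s IH v; rewrite IH eigen_shiftE linearB linearZ /=.
  by rewrite (rVof_app b b_basis).
move: M; case: (\dim _) => [|n] M; first by exists [::] => u; rewrite thinmx0.
have [s sE] := closed_field_poly_normal (char_poly M).
exists s => u; have : u *m horner_mx M (char_poly M) = 0.
  by rewrite Cayley_Hamilton mulmx0.
rewrite sE (monicP (char_poly_monic M)) scale1r => {sE}.
elim: s u => [|a s IH] u; first by rewrite big_nil rmorph1 mulmx1.
rewrite big_cons rmorphM /= rmorphB /= horner_mx_X horner_mx_C => uE.
by apply: IH; rewrite -uE mulmxA mulmxBr mul_mx_scalar.
Qed.

Lemma gen_eigen_decomposition F W v :
  stable F W -> v \in W -> gen_eigen_sum F W v.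
Proof.
move=> FW; have [s sE] := annihilating_shifts F.
have := sE v; elim: s v {sE} => /= [|a s IH] v.
  by move=> -> _; exact: GenEigenSum0.
move=> /IH sv vW; apply: (gen_eigen_sum_unshift (a := a)) => //.
by apply: sv; apply: stable_shift.
Qed.

Lemma gen_eigen_basis F W : stable F W ->
  exists2 X : (\dim W).-tuple V, basis_of W X
    & forall i, exists a, gen_eigen F a (tnth X i).
Proof.
move=> FW.
have span_of v : gen_eigen_sum F W v -> exists2 s : seq V, v \in <<s>>%VS
    & forall u, u \in s -> u \in W /\ exists a, gen_eigen F a u.
  elim=> [|a u {}v uW ua _ [s vs sE]]; first by exists [::]; rewrite ?mem0v.
  exists (u :: s) => [|z]; first by rewrite span_cons memv_add ?memv_line.
  by rewrite inE => /orP[/eqP ->|/sE //]; split=> //; exists a.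
have [s sW sE] : exists2 s : seq V, (W <= <<s>>)%VS
    & forall u, u \in s -> u \in W /\ exists a, gen_eigen F a u.
  rewrite -{1}(span_basis (vbasisP W)).
  have : {subset (tval (vbasis W) : seq V) <= W} by move=> u /vbasis_mem.
  elim: (tval (vbasis W)) => [|v t IH] tW.
    by exists [::]; rewrite ?span_nil ?subvv.
  have /IH[s sW sE] : {subset t <= W}.
    by move=> u ut; apply: tW; rewrite in_cons ut orbT.
  have [|r vr rE] := span_of v.
    by apply: gen_eigen_decomposition => //; apply: (tW v); rewrite mem_head.
  exists (r ++ s) => [|u]; last by rewrite mem_cat => /orP[/rE|/sE].
  by rewrite span_cons span_cat addvS // -memvE.
have [t ts [t_free tE]] := free_subseq s.
have t_basis : basis_of W t.
  rewrite basisEdim; apply/andP; split; first by rewrite tE.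
  rewrite -(eqnP t_free) dimvS // tE.
  by apply/span_subvP => u /sE [].
have st : size t == \dim W by rewrite -(eqnP t_free) (span_basis t_basis).
exists (Tuple st) => // i.
by have /ts /sE [_] := mem_tnth i (Tuple st).
Qed.

End ClosedGenEigen.

(** * The conjugate of the semisimple part of a matrix *)

(** Hermite interpolation by locally constant values, from the Chinese remainder
    theorem. *)
Lemma poly_interpolation (K : fieldType) (c : K -> K) (s : seq K) N :
  exists q : {poly K},
    forall a, a \in s -> ('X - a%:P) ^+ N %| q - (c a)%:P.
Proof.
elim: s => [|a s [q qE]]; first by exists 0.
have [a_s|a_s] := boolP (a \in s).
  by exists q => b; rewrite inE => /orP[/eqP ->|]; apply: qE.
pose P := \prod_(b <- s) ('X - b%:P).
have : coprimep (P ^+ N) (('X - a%:P) ^+ N).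
  by rewrite coprimep_expl ?coprimep_expr // coprimep_XsubC root_prod_XsubC.
case/Bezout_eq1_coprimepP => [[u w]] /= uwE.
exists (q + u * P ^+ N * ((c a)%:P - q)) => b; rewrite inE => /orP[/eqP ->|bs].
  have -> : q + u * P ^+ N * ((c a)%:P - q) - (c a)%:P
            = w * ('X - a%:P) ^+ N * (q - (c a)%:P).
    have -> : w * ('X - a%:P) ^+ N = 1 - u * P ^+ N.
      by rewrite -uwE addrAC subrr add0r.
    by ring.
  by rewrite -mulrA mulrCA dvdp_mulr.
rewrite addrAC dvdp_add ?qE // -mulrA mulrCA dvdp_mulr //.
by rewrite /P (big_rem b) //= exprMn dvdp_mulr.
Qed.

Section Triangular.
Variables (R : comNzRingType) (n : nat).
Implicit Types A B : 'M[R]_n.+1.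

Lemma mul_trig_mx A B : is_trig_mx A -> is_trig_mx B ->
  is_trig_mx (A *m B) /\ forall i, (A *m B) i i = A i i * B i i.
Proof.
move=> /is_trig_mxP At /is_trig_mxP Bt; split=> [|i].
  apply/is_trig_mxP => i j ij; rewrite mxE big1 // => k _.
  have [ik|ki] := ltnP i k; first by rewrite At ?mul0r.
  by rewrite Bt ?mulr0 // (leq_ltn_trans ki).
rewrite mxE (bigD1 i) //= big1 ?addr0 // => k ki.
have [ik|] := ltnP i k; first by rewrite At ?mul0r.
by rewrite leq_eqVlt [_ == _](negPf ki) /= => ik; rewrite Bt ?mulr0.
Qed.

Lemma horner_trig_mx A (p : {poly R}) : is_trig_mx A ->
  is_trig_mx (horner_mx A p) /\ forall i, horner_mx A p i i = p.[A i i].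
Proof.
move=> At; elim/poly_ind: p => [|p c [pt pE]].
  by rewrite rmorph0 mx0_is_trig; split=> // i; rewrite mxE horner0.
rewrite rmorphD rmorphM /= horner_mx_X horner_mx_C.
have [pAt pAE] := mul_trig_mx pt At; split=> [|i].
  apply/is_trig_mxP => i j ij; rewrite mxE (is_trig_mxP pAt) // !mxE.
  by rewrite -val_eqE /= ltn_eqF // addr0.
by rewrite mxE pAE pE !mxE eqxx hornerMXaddC.
Qed.

End Triangular.

Section SemisimpleConjugate.
Variable C : numClosedFieldType.

Lemma shift_iter_horner n (M : 'M[C]_n.+1) a N (v : 'rV_n.+1) :
  iter N (fun u : 'rV_n.+1 => u *m M - a *: u) v
  = v *m horner_mx M (('X - a%:P) ^+ N).
Proof.
elim: N => [|N IH]; first by rewrite expr0 rmorph1 mulmx1.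
rewrite iterS IH exprSr rmorphM /= rmorphB /= horner_mx_X horner_mx_C.
by rewrite mulmxA mulmxBr mul_mx_scalar.
Qed.

(** D is the complex conjugate of the semisimple part of M.  In a Schur
    triangulation of M with diagonal T_ii, the matrix M D has diagonal
    T_ii T_ii^* = |T_ii|^2, so its trace vanishes only if every T_ii does. *)
Lemma semisimple_conjugate n (M : 'M[C]_n) : exists D : 'M[C]_n,
  (forall a N (v : 'rV_n), iter N (fun u : 'rV_n => u *m M - a *: u) v = 0 ->
      v *m D = a^* *: v)
  /\ (\tr (M *m D) = 0 ->
      exists N, forall v : 'rV_n, iter N (fun u : 'rV_n => u *m M) v = 0).
Proof.
case: n M => [|n] M.
  exists 0; split=> [a N v _|_]; last by exists 0%N => v; rewrite thinmx0.
  by rewrite [LHS]thinmx0 [RHS]thinmx0.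
have [P /unitarymx_unit Pu] := Schur M (ltn0Sn n).
rewrite /similar_to conjumx //; set T := _ *m invmx P => Tt.
have MT p : horner_mx M p = invmx P *m horner_mx T p *m P.
  rewrite -horner_mx_uconjC // /T; congr (horner_mx _ p).
  by rewrite mulmxA mulmxKV // mulmxA mulVmx // mul1mx.
pose s := [seq T i i | i : 'I_n.+1].
(* chi, the characteristic polynomial, annihilates M by Cayley-Hamilton; D is
   q(M) where q takes the value a^* to order size chi at each root a of chi. *)
pose chi := \prod_(a <- s) ('X - a%:P).
have chi0 : horner_mx M chi = 0.
  have -> : chi = char_poly T.
    by rewrite char_poly_trig // /chi /s big_map enumT.
  by rewrite MT Cayley_Hamilton mulmx0 mul0mx.
have chi_neq0 : chi != 0 by rewrite monic_neq0 ?monic_prod_XsubC.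
have [q qE] := poly_interpolation (fun a : C => a^*) s (size chi).
have q_diag i : q.[T i i] = (T i i)^*.
  have /qE : T i i \in s by apply/mapP; exists i; rewrite ?mem_enum.
  case/dvdpP => r /(congr1 (horner^~ (T i i))).
  rewrite !hornerE subrr expr0n size_poly_eq0 (negPf chi_neq0).
  by rewrite mulr0 => /eqP; rewrite subr_eq0 => /eqP.
exists (horner_mx M q); split=> [a N v|].
  rewrite shift_iter_horner => vN.
  (* v is killed by ('X - a)^N and by chi, hence by their gcd, which divides
     ('X - a)^m for the multiplicity m <= size chi of a. *)
  have [m [r [ra chiE]]] := multiplicity_XsubC chi a.
  rewrite chi_neq0 /= in ra.
  have : coprimep r (('X - a%:P) ^+ N).
    by rewrite coprimep_expr // coprimep_XsubC.
  case/Bezout_eq1_coprimepP => [[u w]] /= uwE.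
  have vm : v *m horner_mx M (('X - a%:P) ^+ m) = 0.
    rewrite -[X in horner_mx M X]mul1r -uwE mulrDl -!mulrA -chiE.
    rewrite rmorphD rmorphM /= chi0 mulr0 add0r.
    rewrite [_ ^+ N * _]mulrC !mulrA [_ * _ ^+ N]mulrC rmorphM /= mulmxA.
    by rewrite vN mul0mx.
  have [a_s|a_s] := boolP (a \in s); last first.
    case: m chiE vm => [|m] chiE.
      by rewrite expr0 rmorph1 mulmx1 => ->; rewrite mul0mx scaler0.
    have : root chi a by rewrite chiE rootM root_exp_XsubC eqxx orbT.
    by rewrite root_prod_XsubC (negPf a_s).
  have m_size : (m <= size chi)%N.
    have : ('X - a%:P) ^+ m %| chi by rewrite chiE dvdp_mull.
    by move/(dvdp_leq chi_neq0); rewrite size_exp_XsubC; apply: ltnW.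
  have /(dvdp_trans (dvdp_exp2l _ m_size)) /dvdpP [r' r'E] := qE _ a_s.
  rewrite -[q](subrK (a^*)%:P) r'E rmorphD /= mulrC rmorphM /= horner_mx_C.
  by rewrite mulmxDr mulmxA vm mul0mx add0r mul_mx_scalar.
have {1}-> : M = invmx P *m T *m P.
  by rewrite -[in LHS](horner_mx_X M) MT horner_mx_X.
rewrite MT !mulmxA mulmxK // mxtrace_mulC !mulmxA mulmxV // mul1mx.
have [qt qtE] := horner_trig_mx q Tt.
have [_ TqE] := mul_trig_mx Tt qt.
rewrite /mxtrace; under eq_bigr do rewrite TqE qtE q_diag -normCK.
move=> /psumr_eq0P T0; exists n.+1 => v.
have chiX : chi = 'X^(n.+1).
  rewrite /chi /s big_map enumT (eq_bigr (fun=> 'X)) => [|i _].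
    by rewrite big_const_seq count_predT -enumT size_enum_ord iter_mulr_1.
  have /eqP := T0 (fun i _ => exprn_ge0 2 (normr_ge0 (T i i))) i isT.
  by rewrite expf_eq0 /= normr_eq0 => /eqP ->; rewrite subr0.
have := shift_iter_horner M 0 n.+1 v; rewrite subr0 -chiX chi0 mulmx0 => <-.
by apply: eq_iter => u; rewrite scale0r subr0.
Qed.

End SemisimpleConjugate.

(** * Invariance of the Killing form, Engel's theorem, Cartan's criterion *)

Section LieBasics.
Variables (K : fieldType) (g : lieAlgType K).
Implicit Types (x y z u v : g) (U V W J : {vspace g}).

Lemma lie_addl x y z : [lie x + y, z] = [lie x, z] + [lie y, z].
Proof. by rewrite -[x in LHS]scale1r lieDl scale1r. Qed.

Lemma lie0l z : [lie 0, z] = 0.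
Proof. by apply: (addrI [lie 0, z]); rewrite -lie_addl !addr0. Qed.

Lemma lie_scalel a x z : [lie a *: x, z] = a *: [lie x, z].
Proof. by rewrite -[a *: x]addr0 lieDl lie0l addr0. Qed.

Lemma lieC x y : [lie x, y] = - [lie y, x].
Proof.
apply/eqP; rewrite -addr_eq0; apply/eqP.
have := liexx (x + y); rewrite lie_addl !linearD /= !liexx.
by rewrite add0r addr0.
Qed.

Lemma lie_subl x y z : [lie x - y, z] = [lie x, z] - [lie y, z].
Proof. by rewrite lie_addl -scaleN1r lie_scalel scaleN1r. Qed.

Lemma lie_suml (I : Type) (r : seq I) (P : pred I) (F : I -> g) z :
  [lie \sum_(i <- r | P i) F i, z] = \sum_(i <- r | P i) [lie F i, z].
Proof.
by elim/big_rec2: _ => [|i u v _ <-]; rewrite ?lie0l ?lie_addl.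
Qed.

Lemma lie_leibniz x y z :
  [lie x, [lie y, z]] = [lie [lie x, y], z] + [lie y, [lie x, z]].
Proof.
have /eqP := lie_jacobi x y z; rewrite -addrA addr_eq0 => /eqP ->.
rewrite [in RHS]addrC [ [lie [lie x, y], z] ]lieC [ [lie x, z] ]lieC.
by rewrite linearN /= -opprD.
Qed.

Lemma ad_lie x y : ad [lie x, y] = ((ad x \o ad y) - (ad y \o ad x))%VF.
Proof.
apply/lfunP => z; rewrite add_lfunE opp_lfunE !comp_lfunE !adE lie_leibniz.
by rewrite addrK.
Qed.

Definition ltrace (F : 'End(g)) : K :=
  \tr (mxof (vbasis {:g}) (vbasis {:g}) F).

Fact ltrace_is_linear : linear (ltrace : 'End(g) -> K^o).
Proof. by move=> a F G; rewrite /ltrace !linearP. Qed.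
HB.instance Definition _ :=
  GRing.isLinear.Build K 'End(g) K^o _ (ltrace : 'End(g) -> K^o)
    ltrace_is_linear.

Lemma mxof_comp_End (F G : 'End(g)) :
  mxof (vbasis {:g}) (vbasis {:g}) (F \o G)%VF =
  mxof (vbasis {:g}) (vbasis {:g}) G *m mxof (vbasis {:g}) (vbasis {:g}) F.
Proof. by apply: mxof_comp; apply: vbasisP. Qed.

Lemma ltrace_compC (F G : 'End(g)) : ltrace (F \o G)%VF = ltrace (G \o F)%VF.
Proof. by rewrite /ltrace !mxof_comp_End mxtrace_mulC. Qed.

Lemma killing_lie x y z : killing [lie x, y] z = killing x [lie y, z].
Proof.
rewrite -![killing _ _]/(ltrace _) !ad_lie.
rewrite comp_lfunDl comp_lfunDr comp_lfunNl comp_lfunNr !linearB /=.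
by rewrite -!comp_lfunA [ltrace (ad y \o _)%VF]ltrace_compC -comp_lfunA.
Qed.

Lemma killing_addl x y z : killing (x + y) z = killing x z + killing y z.
Proof. by rewrite killingC linearD /= ![killing z _]killingC. Qed.

Lemma killing_scalel a x z : killing (a *: x) z = a * killing x z.
Proof. by rewrite killingC linearZ /= killingC. Qed.

Lemma killing_subl x y z : killing (x - y) z = killing x z - killing y z.
Proof. by rewrite killingC linearB /= ![killing z _]killingC. Qed.

Lemma killing_suml (I : Type) (r : seq I) (P : pred I) (F : I -> g) z :
  killing (\sum_(i <- r | P i) F i) z = \sum_(i <- r | P i) killing (F i) z.
Proof.
by rewrite killingC linear_sum /=; apply: eq_bigr => i _; rewrite killingC.
Qed.

Lemma mem_lie_span U V u v : u \in U -> v \in V -> [lie u, v] \in lie_span U V.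
Proof.
move=> uU vV; rewrite (coord_vbasis uU) (coord_vbasis vV) lie_suml.
apply: memv_suml => i _; rewrite linear_sum; apply: memv_suml => j _ /=.
rewrite lie_scalel linearZ /= !memvZ // memv_span //.
by apply: allpairs_f; apply: mem_nth; rewrite size_tuple.
Qed.

Lemma lie_span_sub U V W :
  (forall u v, u \in U -> v \in V -> [lie u, v] \in W) ->
  (lie_span U V <= W)%VS.
Proof.
move=> H; apply/span_subvP => w /allpairsP [[u v] /= [uU vV ->]].
by apply: H; apply: vbasis_mem.
Qed.

(** For a derivation F, F - (a + b) acts on [u, v] as (F - a) on u plus (F - b)
    on v, so the orders of nilpotency add up. *)
Lemma gen_eigen_lie (F : 'End(g)) a b u v :
  (forall y z, F [lie y, z] = [lie F y, z] + [lie y, F z]) ->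
  gen_eigen F a u -> gen_eigen F b v -> gen_eigen F (a + b) [lie u, v].
Proof.
move=> FD [M Mu] [N Nv]; have [n] := ubnP (M + N).
elim: n M N u v Mu Nv => // n IH M N u v Mu Nv /ltnSE MN.
case: M Mu MN => [/= ->|M Mu] MN; first by rewrite lie0l; apply: gen_eigen0.
case: N Nv MN => [/= ->|N Nv] MN; first by rewrite linear0; apply: gen_eigen0.
apply: gen_eigen_shift.
have -> : eigen_shift F (a + b) [lie u, v]
          = [lie eigen_shift F a u, v] + [lie u, eigen_shift F b v].
  rewrite !eigen_shiftE FD lie_subl lie_scalel scalerDl opprD.
  by rewrite [ [lie u, _ - _] ]linearB /= [ [lie u, b *: v] ]linearZ addrACA.
apply: gen_eigenD.
  by apply: (IH M N.+1) => //; rewrite -iterSr.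
by apply: (IH M.+1 N); rewrite -?iterSr // addSnnS.
Qed.

Definition lie_stable U W := forall u w, u \in U -> w \in W -> [lie u, w] \in W.

Definition ad_nilpotent x := exists N, forall v, iter N (lie x) v = 0.

(** The conclusion of Engel's theorem for the action of M on every subquotient
    W / U of the adjoint representation; subquotients are what the induction on
    the dimension of M requires. *)
Definition engel_vector M := forall U W,
  ~~ (W <= U)%VS -> lie_stable M U -> lie_stable M W ->
  exists v, [/\ v \in W, v \notin U & forall y, y \in M -> [lie y, v] \in U].

Lemma lie_stable_addv_line M y U :
  lie_stable M U -> (forall u, u \in U -> [lie y, u] \in U) ->
  lie_stable (M + <[y]>) U.
Proof.
move=> MU yU _ u /memv_addP[z zM [_ /vlineP[c ->] ->]] uU.
by rewrite lie_addl lie_scalel memvD ?memvZ ?yU ?MU.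
Qed.

Lemma dimv_add_line U v : v \notin U -> \dim (U + <[v]>) = (\dim U).+1.
Proof.
move=> vU; have v0 : v != 0 by apply: contraNneq vU => ->; apply: mem0v.
rewrite dimv_disjoint_sum ?dim_vline ?v0 ?addn1 //.
apply/eqP; rewrite -subv0; apply/subvP => w; rewrite memv_cap => /andP[wU].
case/vlineP => c wE; rewrite memv0; rewrite {}wE in wU *.
have [->|c0] := eqVneq c 0; first by rewrite scale0r.
by rewrite -[v](scalerK c0) memvZ in vU.
Qed.

Lemma engel_theorem J : lie_stable J J ->
  (forall y, y \in J -> ad_nilpotent y) -> engel_vector J.
Proof.
move=> JJ Jnil.
(* Subalgebras with the property exist in every dimension d <= \dim J: the
   property for M, applied to J modulo M, gives y outside M normalizing M, and
   ad y acts nilpotently on the vectors of W killed by M modulo U. *)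
have [M [MJ MM Mdim Mv]] : exists M, [/\ (M <= J)%VS, lie_stable M M,
    \dim M = \dim J & engel_vector M].
  have : (\dim J <= \dim J)%N by [].
  elim: {1 3}(\dim J) => [|d IH] dJ.
    exists 0%VS; split; rewrite ?sub0v ?dimv0 //.
      by move=> u w _; rewrite !memv0 => /eqP ->; rewrite linear0.
    move=> U W /subvPn [v vW vU] _ _; exists v; split=> // y.
    by rewrite memv0 => /eqP ->; rewrite lie0l mem0v.
  have [M [MJ MM Mdim Mv]] := IH (ltnW dJ).
  have MJ' : lie_stable M J by move=> u w /(subvP MJ); apply: JJ.
  have JM : ~~ (J <= M)%VS.
    by apply: contraTN dJ => /dimvS; rewrite Mdim -ltnNge.
  have [y [yJ yM yE]] := Mv M J JM MM MJ'.
  have yM' u : u \in M -> [lie y, u] \in M.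
    by move=> uM; rewrite lieC memvN yE.
  exists (M + <[y]>)%VS; split; last 1 first.
  - move=> U W WU HU HW.
    have My z : z \in M -> z \in (M + <[y]>)%VS by apply/subvP/addvSl.
    have yy : y \in (M + <[y]>)%VS.
      by apply: (subvP (addvSr _ _)); apply: memv_line.
    have MU : lie_stable M U by move=> u w /My; apply: HU.
    have MW : lie_stable M W by move=> u w /My; apply: HW.
    have [v [vW vU vE]] := Mv U W WU MU MW.
    have [N yN] := Jnil y yJ.
    have [||j jU jU'] := @iter_last _ (lie y) (mem U) N v;
      rewrite ?inE ?yN ?mem0v //.
    exists (iter j (lie y) v).
    have [jW jE] : iter j (lie y) v \in W /\
        forall z, z \in M -> [lie z, iter j (lie y) v] \in U.
      elim: j {jU jU'} => //= j [jW jE]; split; first exact: HW.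
      by move=> z zM; rewrite lie_leibniz memvD ?jE ?yE // HU // jE.
    split=> // z /memv_addP[t tM [_ /vlineP[c ->] ->]].
    by rewrite lie_addl lie_scalel memvD ?jE // memvZ.
  - by rewrite subv_add MJ -memvE.
  - apply: lie_stable_addv_line => [u w uM|w].
      case/memv_addP=> [t tM [_ /vlineP[c ->] ->]]; rewrite linearD linearZ /=.
      by rewrite (subvP (addvSl _ _)) // memvD ?MM // memvZ // yE.
    case/memv_addP=> [t tM [_ /vlineP[c ->] ->]]; rewrite linearD linearZ /=.
    by rewrite liexx scaler0 addr0 (subvP (addvSl _ _)) // yM'.
  - by rewrite dimv_add_line // Mdim.
by have /eqP <- : M == J by rewrite eqEdim MJ Mdim leqnn.
Qed.

Lemma perfect_ad_nilpotent_eq0 J : (J <= lie_span J J)%VS -> lie_stable J J ->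
  (forall y, y \in J -> ad_nilpotent y) -> J = 0%VS.
Proof.
move=> Jperf JJ /(engel_theorem JJ) Jv.
have step U : lie_stable J U -> (\dim U < \dim J)%N -> exists v,
    [/\ v \in J, v \notin U & forall y, y \in J -> [lie y, v] \in U].
  move=> JU dU; apply: Jv => //.
  by apply: contraTN dU => /dimvS; rewrite -leqNgt.
apply/eqP; rewrite -dimv_eq0; case E: (\dim J) => [//|d].
(* An ideal U of J of codimension one; then [J, J] lies in U. *)
have [U [UJ JU dU]] : exists U, [/\ (U <= J)%VS, lie_stable J U & \dim U = d].
  have : (d < \dim J)%N by rewrite E.
  elim: d {E} => [|d IH] dJ.
    exists 0%VS; rewrite sub0v dimv0; split=> // u w _.
    by rewrite memv0 => /eqP ->; rewrite linear0 mem0v.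
  have [U [UJ JU dU]] := IH (ltnW dJ).
  have [|v [vJ vU vE]] := step U JU; first by rewrite dU ltnW.
  exists (U + <[v]>)%VS; rewrite dimv_add_line // dU subv_add UJ -memvE.
  split=> // y w yJ /memv_addP[t tU [_ /vlineP[c ->] ->]].
  by rewrite linearD linearZ /= (subvP (addvSl _ _)) // memvD ?JU // memvZ ?vE.
have [|v [vJ vU vE]] := step U JU; first by rewrite dU E.
have JE : J = (U + <[v]>)%VS.
  apply/esym/eqP; rewrite eqEdim subv_add UJ -memvE vJ dimv_add_line //.
  by rewrite dU E /=.
have : (J <= U)%VS.
  apply: subv_trans Jperf _; apply: lie_span_sub => u w uJ.
  rewrite JE => /memv_addP[t tU [_ /vlineP[c ->] ->]].
  by rewrite linearD linearZ /= memvD ?JU // memvZ ?vE.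
by move/dimvS; rewrite E dU ltnn.
Qed.

(** J is the term at which the derived series of I becomes stationary, which
    happens by dimension. *)
Lemma perfect_core I : lie_stable I I ->
  exists J, [/\ (J <= I)%VS, lie_span J J = J
               & J = 0%VS -> solvable_subspace I].
Proof.
move=> II; pose D d := iter d (fun U => lie_span U U) I.
have DS d : (D d.+1 <= D d)%VS /\ (D d <= I)%VS.
  elim: d => [|d [DS DI]]; first by split; [apply: lie_span_sub|apply: subvv].
  split; last exact: subv_trans DI.
  apply: lie_span_sub => u v uD vD.
  by apply: mem_lie_span; apply: (subvP DS).
have [d DE] : exists d, D d.+1 = D d.
  have [/existsP [d /eqP DE]|] :=
    boolP [exists d : 'I_(\dim I).+1, D d.+1 == D d]; first by exists d.
  rewrite negb_exists => /forallP DN.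
  suff H d : (d <= (\dim I).+1)%N -> (\dim (D d) + d <= \dim I)%N.
    by have := H _ (leqnn _); rewrite addnC -ltn_subRL subnn.
  elim: d => [|d IH] dI; first by rewrite addn0.
  apply: leq_trans (IH (ltnW dI)); rewrite addnS -addSn leq_add2r.
  rewrite ltnNge; apply: contra (DN (Ordinal dI)) => dD.
  by rewrite eqEdim (DS d).1.
by exists (D d); split=> //; [exact: (DS d).2 | move=> D0; exists d].
Qed.

End LieBasics.

Section Cartan.
Variables (C : numClosedFieldType) (g : lieAlgType C).
Implicit Types (x y z u v : g) (U V W J : {vspace g}).

(** The conjugate D of the semisimple part of ad x is a derivation, because
    a |-> a^* is additive.  Thus D ad v = ad (D v) + ad v D, and the trace of
    D ad [u, v] is - <D v|u> = 0; as x is a sum of brackets of elements of J,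
    tr (D ad x) = 0, which is the criterion of semisimple_conjugate. *)
Lemma perfect_killing_null_ad_nilpotent J x : lie_span J J = J ->
  (forall u v, u \in J -> killing u v = 0) -> x \in J -> ad_nilpotent x.
Proof.
move=> Jperf JK xJ; pose b := vbasis {:g}.
have b_basis : basis_of {:g} b by apply: vbasisP.
have [D' [D'E D'tr]] := semisimple_conjugate (mxof b b (ad x)).
pose D := hommx b b D'.
have iterE a N v :
    iter N (fun u : 'rV_(\dim {:g}) => u *m mxof b b (ad x) - a *: u) (rVof b v)
    = rVof b (iter N (eigen_shift (ad x) a) v).
  elim: N => //= N ->; rewrite eigen_shiftE linearB /= (rVof_app b b_basis).
  by rewrite [rVof b (a *: _)]linearZ.
have DE a v : gen_eigen (ad x) a v -> D v = a^* *: v.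
  move=> [N Nv]; have := D'E a N (rVof b v); rewrite iterE Nv linear0.
  move=> /(_ erefl) vD; rewrite /D hommxE // -[RHS](rVofK b_basis).
  by congr (vecof b _); rewrite [RHS]linearZ.
have adD y z : ad x [lie y, z] = [lie ad x y, z] + [lie y, ad x z].
  by rewrite !adE lie_leibniz.
have full (w : g) : gen_eigen_sum (ad x) {:g} w.
  by apply: gen_eigen_decomposition; rewrite ?memvf // => ? _; rewrite memvf.
have Dder_eigen a u v : gen_eigen (ad x) a u ->
    D [lie u, v] = [lie D u, v] + [lie u, D v].
  move=> ua; elim: (full v) => [|a' {}v v' _ va' _ IH].
    by rewrite !linear0 addr0.
  rewrite !linearD /= IH addrACA; congr (_ + _).
  have uv := gen_eigen_lie adD ua va'.
  rewrite (DE _ _ uv) (DE _ _ ua) (DE _ _ va') linearZ /= lie_scalel.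
  by rewrite rmorphD scalerDl.
have Dder u v : D [lie u, v] = [lie D u, v] + [lie u, D v].
  elim: (full u) => [|a {}u u' _ ua _ IH].
    by rewrite !(lie0l, linear0) addr0.
  rewrite [D (u + u')]linearD /= !lie_addl linearD /= IH (Dder_eigen _ _ _ ua).
  exact: addrACA.
have Dad v : (D \o ad v = ad (D v) + (ad v \o D))%VF.
  by apply/lfunP => w; rewrite add_lfunE !comp_lfunE !adE Dder.
have tr_lie u v : u \in J -> ltrace (D \o ad [lie u, v])%VF = 0.
  have cyc : ltrace (D \o (ad u \o ad v))%VF = ltrace ((ad v \o D) \o ad u)%VF.
    by rewrite ltrace_compC -comp_lfunA ltrace_compC.
  move=> uJ; rewrite ad_lie comp_lfunDr comp_lfunNr linearB /= cyc.
  rewrite [X in _ - ltrace X]comp_lfunA Dad comp_lfunDl linearD /= opprD addrCA.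
  by rewrite subrr addr0 ltrace_compC -[ltrace _]/(killing _ _) JK ?oppr0.
have tr0 y : y \in J -> ltrace (D \o ad y)%VF = 0.
  rewrite -{1}Jperf.
  apply: (span_ind (P := fun y => ltrace (D \o ad y)%VF = 0))
    => [|c u v uE vE|_ /allpairsP[[u v] /= [uJ _ ->]]].
  - by rewrite -(liexx 0) tr_lie ?mem0v.
  - have -> : (D \o ad (c *: u + v) = c *: (D \o ad u) + (D \o ad v))%VF.
      apply/lfunP => w; rewrite add_lfunE scale_lfunE !comp_lfunE !adE.
      by rewrite lieDl linearP.
    by rewrite linearP /= uE vE scaler0 addr0.
  - by rewrite tr_lie // vbasis_mem.
have [|N Nx] := D'tr.
  by have := tr0 x xJ; rewrite /ltrace mxof_comp_End hommxK.
exists N => v; apply: (can_inj (rVofK b_basis)).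
rewrite linear0 -(Nx (rVof b v)).
elim: N {Nx} => //= N <-; rewrite -adE; exact: rVof_app.
Qed.

(** Cartan's criterion: the perfect core of the radical of the Killing form
    consists of ad-nilpotent elements, hence is zero by Engel's theorem, so that
    the radical is a solvable ideal. *)
Lemma killing_nondegenerate : semisimple_lie g ->
  forall x, (forall y, killing x y = 0) -> x = 0.
Proof.
move=> ss x xK; pose I := kperp ({:g} : {vspace g}).
have IP y : reflect (forall u, killing y u = 0) (y \in I).
  apply: (iffP (kperpP _ _)) => H u; last by rewrite killingC.
  by rewrite killingC H ?memvf.
have I_ideal : lie_ideal I.
  move=> y z /IP zI; apply/IP => u.
  by rewrite lieC -scaleN1r killing_scalel killing_lie zI mulr0.
have xI : x \in I by apply/IP.
have II : lie_stable I I by move=> u w _; apply: I_ideal.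
suff : I = 0%VS by move=> I0; apply/eqP; rewrite -memv0 -I0.
apply: ss => //.
have [J [JI Jperf]] := perfect_core II; apply.
have Jnil y : y \in J -> ad_nilpotent y.
  by apply: perfect_killing_null_ad_nilpotent => // u v /(subvP JI) /IP.
apply: perfect_ad_nilpotent_eq0 Jnil; first by rewrite Jperf subvv.
by move=> u v uJ vJ; rewrite -Jperf mem_lie_span.
Qed.

End Cartan.

(** * Orthogonality for the Killing form and Dirac reduction *)

Section TupleBasis.
Variables (K : fieldType) (V : vectType K) (W : {vspace V}).
Variables (m : nat) (X : m.-tuple V).

Lemma basis_sum v : basis_of W X -> v \in W ->
  v = \sum_i coord X i v *: tnth X i.
Proof.
move=> X_basis vW; rewrite {1}(coord_basis X_basis vW).
by apply: eq_bigr => i _; rewrite (tnth_nth 0).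
Qed.

Lemma mem_basis i : basis_of W X -> tnth X i \in W.
Proof. by move=> X_basis; apply: (basis_mem X_basis); apply: mem_tnth. Qed.

Lemma free_sum_eq0 (c : 'I_m -> K) : free X ->
  \sum_i c i *: tnth X i = 0 -> forall i, c i = 0.
Proof.
move=> /freeP X_free c0; apply: X_free; rewrite -[RHS]c0.
by apply: eq_bigr => i _; rewrite (tnth_nth 0).
Qed.

End TupleBasis.

Lemma unitmx_ker0 (K : fieldType) m (A : 'M[K]_m) :
  (forall v : 'rV_m, v *m A = 0 -> v = 0) -> A \in unitmx.
Proof.
move=> A0; rewrite -row_free_unit -kermx_eq0; apply/rowV0P => v /sub_kermxP.
exact: A0.
Qed.

Section KillingPerp.
Variables (K : fieldType) (g : lieAlgType K).
Implicit Types (x y z u v w s e h : g) (U V W : {vspace g}).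
Hypothesis nondeg : forall x, (forall y, killing x y = 0) -> x = 0.

Lemma killing_perp_mem U u y : u \in U -> y \in kperp U -> killing u y = 0.
Proof. by move=> uU /kperpP; apply. Qed.

Lemma kperp_cap U V : (kperp U :&: kperp V <= kperp (U + V))%VS.
Proof.
apply/subvP => y /memv_capP[/kperpP yU /kperpP yV].
apply/kperpP => _ /memv_addP[u uU [v vV ->]].
by rewrite killing_addl yU ?yV ?addr0.
Qed.

Lemma kperp_full : kperp {:g} = 0%VS.
Proof.
apply/eqP; rewrite -subv0; apply/subvP => y /kperpP yK; rewrite memv0.
by apply/eqP/nondeg => u; rewrite killingC yK ?memvf.
Qed.

Lemma dim_kperp_geq U : (\dim {:g} <= \dim (kperp U) + \dim U)%N.
Proof.
rewrite /kperp -{2}(size_tuple (vbasis U)).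
elim: (tval (vbasis U)) => [|u r IH]; first by rewrite big_nil addn0.
rewrite big_cons /=; set phi := linfun _.
set W := (\bigcap_(_ <- _) _)%VS in IH *.
apply: leq_trans IH _; rewrite addnS -addSn leq_add2r.
rewrite -(limg_ker_dim phi W) capvC -addn1 leq_add2l.
by rewrite (leq_trans (dimvS (subvf _))) // dimvf.
Qed.

Lemma dim_kperp U : (\dim (kperp U) + \dim U)%N = \dim {:g}.
Proof.
apply/eqP; rewrite eqn_leq dim_kperp_geq andbT.
(* The lower bound for a complement of U gives the upper bound for U. *)
have cap0 : (kperp U :&: kperp U^C = 0)%VS.
  apply/eqP; rewrite -subv0 -kperp_full -(addv_complf U).
  exact: kperp_cap.
have := dimvS (subvf (kperp U + kperp U^C)); rewrite dimv_disjoint_sum //.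
have := dim_kperp_geq U^C; rewrite dimv_compl.
have := dimvS (subvf U); move: (\dim _) (\dim U) (\dim _) (\dim _) => a b c d.
by move=> *; lia.
Qed.

Lemma kperpK U : kperp (kperp U) = U.
Proof.
apply/esym/eqP; rewrite eqEdim; apply/andP; split.
  apply/subvP => u uU; apply/kperpP => v vU.
  by rewrite killingC (killing_perp_mem uU).
by rewrite -(leq_add2l (\dim (kperp U))) dim_kperp addnC dim_kperp.
Qed.

Lemma kperp_compl U V : (U :&: V = 0)%VS -> (U + V)%VS = {:g}%VS ->
  (kperp U :&: kperp V = 0)%VS /\ (kperp U + kperp V)%VS = {:g}%VS.
Proof.
move=> UV0 UV1; have cap0 : (kperp U :&: kperp V = 0)%VS.
  by apply/eqP; rewrite -subv0 -kperp_full -UV1 kperp_cap.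
split=> //; apply/eqP; rewrite eqEdim subvf dimv_disjoint_sum //=.
have := dimv_disjoint_sum UV0; rewrite UV1.
have := dim_kperp U; have := dim_kperp V.
move: (\dim _) (\dim U) (\dim _) (\dim _) (\dim V) => *; lia.
Qed.

Lemma mem_centralizer y v : (v \in centralizer y) = ([lie y, v] == 0).
Proof. by rewrite memv_ker adE. Qed.

Lemma centralizer_lie y u v : u \in centralizer y -> v \in centralizer y ->
  [lie u, v] \in centralizer y.
Proof.
rewrite !mem_centralizer lie_leibniz => /eqP -> /eqP ->.
by rewrite lie0l linear0 addr0.
Qed.

(** Invariance of the form gives one inclusion, a dimension count the other. *)
Lemma orbit_tangentE x : orbit_tangent x = kperp (centralizer x).
Proof.
apply/eqP; rewrite eqEdim; apply/andP; split.
  apply/subvP => _ /memv_imgP[v _ ->]; rewrite adE; apply/kperpP => u.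
  rewrite mem_centralizer => /eqP xu; rewrite -killing_lie lieC xu.
  by rewrite oppr0 killingC linear0.
have := limg_ker_dim (ad x) {:g}; have := dim_kperp (centralizer x).
rewrite capfv -/(centralizer x) -/(orbit_tangent x).
move: (\dim _) (\dim _) (\dim _) (\dim _) => *; lia.
Qed.

Lemma semisimple_iter_eq0 s v N : semisimple_elt s ->
  iter N (lie s) v = 0 -> [lie s, v] = 0.
Proof.
case=> b b_basis bs; pose B := in_tuple b.
have B_basis : basis_of {:g} B by [].
have B_free := basis_free B_basis.
have [a aE] : exists a : 'I_(size b) -> K,
    forall i, [lie s, tnth B i] = a i *: tnth B i.
  apply: (@fin_all_exists _ (fun=> K)
    (fun i c => [lie s, tnth B i] = c *: tnth B i)) => i.
  exact/bs/mem_tnth.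
have vE := basis_sum B_basis (memvf v).
have iterE n : iter n (lie s) v = \sum_i (coord B i v * a i ^+ n) *: tnth B i.
  elim: n => [|n IH].
    by rewrite [LHS]vE; apply: eq_bigr => i _; rewrite mulr1.
  rewrite iterS IH linear_sum; apply: eq_bigr => i _ /=.
  by rewrite linearZ /= aE scalerA exprSr mulrA.
rewrite iterE => /(free_sum_eq0 B_free) c0.
rewrite -[LHS]/(iter 1 (lie s) v) iterE big1 // => i _.
have /eqP := c0 i; rewrite mulf_eq0 expf_eq0 => /orP[|/andP[_]] /eqP ->;
by rewrite ?mulr0 ?mul0r scale0r.
Qed.

Lemma semisimple_centralizer_cap s : semisimple_elt s ->
  (centralizer s :&: kperp (centralizer s) = 0)%VS.
Proof.
move=> ss; apply/eqP; rewrite -subv0 -(orbit_tangentE s).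
apply/subvP => w /memv_capP[+ /memv_imgP[v _ wE]].
rewrite wE mem_centralizer !adE memv0 => /eqP sv.
by rewrite (semisimple_iter_eq0 (N := 2) ss).
Qed.

Lemma semisimple_centralizer_sum s : semisimple_elt s ->
  (kperp (centralizer s) + centralizer s)%VS = {:g}%VS.
Proof.
move=> ss; apply/eqP; rewrite eqEdim subvf /= dimv_disjoint_sum ?dim_kperp //.
by rewrite capvC semisimple_centralizer_cap.
Qed.

Lemma jordan_centralizer x s e : jordan_chevalley x s e ->
  centralizer x = (centralizer s :&: centralizer e)%VS.
Proof.
case=> -> ss [N eN] se; apply/vspaceP => v.
rewrite memv_cap !mem_centralizer lie_addl.
apply/idP/andP => [|[/eqP -> /eqP ->]]; last by rewrite addr0.
rewrite addr_eq0 => /eqP sv.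
suff sv0 : [lie s, v] = 0.
  by move: sv; rewrite sv0 => /esym/eqP; rewrite oppr_eq0.
(* On the kernel of ad x, ad s = - ad e is nilpotent as well as
   diagonalizable. *)
have iterE n : iter n (lie s) v = (-1) ^+ n *: iter n (lie e) v.
  elim: n => [|n IH]; first by rewrite scale1r.
  have siter : [lie s, iter n (lie e) v] = - iter n.+1 (lie e) v.
    elim: n {IH} => //= n IH; rewrite lie_leibniz se lie0l add0r IH.
    by rewrite linearN.
  by rewrite iterS IH linearZ /= siter exprSr mulrN1 scaleNr scalerN.
by apply: (semisimple_iter_eq0 (N := N) ss); rewrite iterE eN scaler0.
Qed.

(** The matrix is the Gram matrix of the form <y|[u,v]> on W in the basis X. *)
Lemma lie_poisson_unit W m (X : m.-tuple g) y : basis_of W X ->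
  (forall u, u \in W ->
     (forall v, v \in W -> killing y [lie u, v] = 0) -> u = 0) ->
  lie_poisson_mx X X y \in unitmx.
Proof.
move=> X_basis Wnd; apply: unitmx_ker0 => v vC.
have v0 : forall i, v 0 i = 0.
  apply: (free_sum_eq0 (basis_free X_basis)); apply: Wnd => [|w wW].
    by apply: memv_suml => i _; rewrite memvZ ?(mem_basis _ X_basis).
  rewrite (basis_sum X_basis wW) !linear_sum big1 // => j _ /=.
  rewrite !linearZ /=.
  suff -> : killing y [lie \sum_i v 0 i *: tnth X i, tnth X j]
            = (v *m lie_poisson_mx X X y) 0 j by rewrite vC mxE scaler0.
  rewrite lie_suml linear_sum mxE; apply: eq_bigr => l _.
  by rewrite mxE lie_scalel linearZ.
by apply/rowP => i; rewrite v0 mxE.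
Qed.

Lemma killing_dual_basis U V k (Z : k.-tuple g) : basis_of V Z ->
  \dim U = k -> (U :&: kperp V = 0)%VS ->
  exists Zd : 'I_k -> g, (forall i, Zd i \in U)
    /\ forall i j, killing (Zd i) (tnth Z j) = (i == j)%:R.
Proof.
move=> Z_basis Uk UV0.
have [Y Y_basis] : exists Y : k.-tuple g, basis_of U Y.
  by case: k / Uk {Z Z_basis}; exists (vbasis U); apply: vbasisP.
pose G := \matrix_(i, j) killing (tnth Y i) (tnth Z j).
have Gu : G \in unitmx.
  apply: unitmx_ker0 => v vG; pose u := \sum_i v 0 i *: tnth Y i.
  have uU : u \in U.
    by apply: memv_suml => i _; rewrite memvZ ?(mem_basis _ Y_basis).
  have u0 : u = 0.
    apply/eqP; rewrite -memv0 -UV0 memv_cap uU; apply/kperpP => w wV.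
    rewrite killingC (basis_sum Z_basis wV) linear_sum big1 // => j _ /=.
    rewrite linearZ /=; suff -> : killing u (tnth Z j) = (v *m G) 0 j.
      by rewrite vG mxE scaler0.
    rewrite killing_suml mxE; apply: eq_bigr => l _.
    by rewrite mxE killing_scalel.
  by apply/rowP => i; rewrite (free_sum_eq0 (basis_free Y_basis) u0) mxE.
exists (fun i => \sum_l invmx G i l *: tnth Y l); split=> [i|i j].
  by apply: memv_suml => l _; rewrite memvZ ?(mem_basis _ Y_basis).
have /matrixP/(_ i j) := mulVmx Gu; rewrite !mxE => <-.
by rewrite killing_suml; apply: eq_bigr => l _; rewrite mxE killing_scalel.
Qed.

(** Basis-free Dirac reduction: the rows of B C^-1 are the coordinates of the
    vectors u of W which have the same brackets with W at y as the Z_i; the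
    correction term is then the bracket with u in place of Z_i. *)
Lemma transverse_poisson_mxE W k (Z : k.-tuple g) m (X : m.-tuple g) y i j u :
  basis_of W X -> lie_poisson_mx X X y \in unitmx -> u \in W ->
  (forall v, v \in W -> killing y [lie u - tnth Z i, v] = 0) ->
  transverse_poisson_mx Z X y i j = killing y [lie tnth Z i - u, tnth Z j].
Proof.
move=> X_basis Cu uW uE; rewrite !mxE lie_subl linearB /=; congr (_ + _).
pose r := \row_l coord X l u.
have rC : r *m lie_poisson_mx X X y = row i (lie_poisson_mx Z X y).
  apply/rowP => l; rewrite !mxE; have := uE _ (mem_basis l X_basis).
  rewrite lie_subl linearB /= => /eqP; rewrite subr_eq0 => /eqP <-.
  rewrite (basis_sum X_basis uW) lie_suml linear_sum /=.
  by apply: eq_bigr => a _; rewrite !mxE lie_scalel linearZ.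
have rE : r = row i (lie_poisson_mx Z X y *m invmx (lie_poisson_mx X X y)).
  by rewrite row_mul -rC mulmxK.
rewrite lieC linearN /= opprK (basis_sum X_basis uW) !linear_sum /=.
apply: eq_bigr => l _; rewrite !linearZ /= mxE; congr (_ * _).
  by have /rowP/(_ l) := rE; rewrite !mxE => ->.
by rewrite !mxE.
Qed.

Lemma dirac_correction W k (Z : k.-tuple g) m (X : m.-tuple g) y i :
  basis_of W X -> lie_poisson_mx X X y \in unitmx ->
  exists2 u, u \in W & forall v, v \in W -> killing y [lie u - tnth Z i, v] = 0.
Proof.
move=> X_basis Cu.
pose r := row i (lie_poisson_mx Z X y) *m invmx (lie_poisson_mx X X y).
exists (\sum_l r 0 l *: tnth X l) => [|v vW].
  by apply: memv_suml => l _; rewrite memvZ ?(mem_basis _ X_basis).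
rewrite (basis_sum X_basis vW) !linear_sum big1 // => j _ /=.
rewrite !linearZ /=.
suff -> : killing y [lie \sum_l r 0 l *: tnth X l - tnth Z i, tnth X j] = 0.
  by rewrite scaler0.
rewrite lie_subl linearB /= lie_suml linear_sum /=.
have rC : r *m lie_poisson_mx X X y = row i (lie_poisson_mx Z X y).
  by rewrite mulmxKV.
apply/eqP; rewrite subr_eq0; apply/eqP.
transitivity ((r *m lie_poisson_mx X X y) 0 j); last by rewrite rC !mxE.
rewrite mxE; apply: eq_bigr => l _.
by rewrite lie_scalel linearZ [X in _ * X]mxE.
Qed.

End KillingPerp.

(** * Dilations and weights *)

Lemma poly_const_of_units (K : numFieldType) (p : {poly K}) c :
  (forall t, t != 0 -> p.[t] = c) -> p.[0] = c.
Proof.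
move=> pc; suff -> : p = c%:P by rewrite hornerC.
apply/eqP; rewrite -subr_eq0; apply/negPn/negP => pc0.
pose r : seq K := [seq i.+1%:R | i <- iota 0 (size (p - c%:P))].
have := @max_poly_roots _ _ r pc0; rewrite size_map size_iota ltnn.
suff [-> ->] : all (root (p - c%:P)) r /\ uniq r by move=> /(_ isT isT).
split; last first.
  by rewrite map_inj_uniq ?iota_uniq // => i j /eqP; rewrite eqr_nat => /eqP [].
apply/allP => _ /mapP[i _ ->].
by rewrite rootE hornerD hornerN hornerC pc ?subrr ?pnatr_eq0.
Qed.

(** Along q_i t^(nu_i) the polynomial d is constant for t <> 0, hence also at
    t = 0, where all the coordinates vanish since the nu_i are positive. *)
Lemma mpoly_scaling_invariant (K : numFieldType) k (nu : 'I_k -> nat)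
    (d : {mpoly K[k]}) : (forall i, 0 < nu i)%N ->
  (forall t, t != 0 -> forall q, d.@[fun i => t ^+ nu i * q i] = d.@[q]) ->
  forall q, d.@[q] = d.@[fun=> 0].
Proof.
move=> nu_gt0 d_inv q.
(* The restriction of d to the dilation orbit of q, a polynomial in t. *)
pose p := mmap polyC (fun i => 'X^(nu i) * (q i)%:P) d.
have pE t : p.[t] = d.@[fun i => t ^+ nu i * q i].
  rewrite /p /meval /mmap horner_sum; apply: eq_bigr => m _.
  rewrite hornerM hornerC /mmap1 horner_prod; congr (_ * _).
  by apply: eq_bigr => i _; rewrite !hornerE.
rewrite -(@poly_const_of_units K p d.@[q]) => [|t t0].
  rewrite pE; apply: meval_eq => i.
  by rewrite expr0n gtn_eqF ?mul0r.
by rewrite pE d_inv.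
Qed.

Lemma dirac_reduction_congr (K : fieldType) k m (N A : 'M[K]_k) (D M : 'M[K]_m)
    (B : 'M[K]_(k, m)) : N^T = N -> D^T = D -> D \in unitmx -> M \in unitmx ->
  N *m A *m N + (N *m B *m D) *m invmx (D *m M *m D) *m (N *m B *m D)^T
  = N *m (A + B *m invmx M *m B^T) *m N.
Proof.
move=> Nt Dt Du Mu.
have -> : invmx (D *m M *m D) = invmx D *m invmx M *m invmx D.
  have DMDu : D *m M *m D \in unitmx by rewrite !unitmx_mul Du Mu.
  apply: (can_inj (mulmxK DMDu)); rewrite mulVmx // -!mulmxA mulKmx //.
  by rewrite [invmx M *m _]mulmxA mulVmx // mul1mx mulVmx.
rewrite !trmx_mul Nt Dt mulmxDr mulmxDl !mulmxA mulmxK //.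
by rewrite [_ *m invmx D *m D]mulmxKV.
Qed.

Section Weights.
Variables (C : numClosedFieldType) (g : lieAlgType C).
Implicit Types (x y z u v w s e h : g) (U V W : {vspace g}).

Lemma ad_derivation x y z : ad x [lie y, z] = [lie ad x y, z] + [lie y, ad x z].
Proof. by rewrite !adE lie_leibniz. Qed.

(** By invariance <u|(ad h - b) v> = - (a + b) <u|v>, and ad h - b is nilpotent
    on v. *)
Lemma killing_weight_eq0 h a b u v : [lie h, u] = a *: u ->
  gen_eigen (ad h) b v -> a + b != 0 -> killing u v = 0.
Proof.
move=> hu [N]; elim: N v => [|N IH] v; first by move=> /= -> _; rewrite linear0.
rewrite iterSr => /IH{}IH ab; have := IH ab; rewrite eigen_shiftE adE.
rewrite linearB linearZ /= -killing_lie lieC hu -scaleN1r.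
rewrite !killing_scalel mulN1r.
rewrite -opprD -mulrDl => /eqP; rewrite oppr_eq0 mulf_eq0 (negPf ab) /=.
by move/eqP.
Qed.

(** Apply ad h - a to v until an eigenvector of weight a remains, then ad e
    until the result is killed by e: its weight a + 2 l is an integer by
    assumption. *)
Lemma gen_weight_integral h e W (I : finType) (w : I -> int) a v :
  [lie h, e] = 2 *: e -> ad_nilpotent e ->
  (forall u, u \in W -> [lie e, u] \in W) ->
  (forall u, u \in W -> [lie h, u] \in W) ->
  (forall u c, u \in W -> u != 0 -> [lie e, u] = 0 -> [lie h, u] = c *: u ->
     exists i, c = (w i)%:~R) ->
  v \in W -> v != 0 -> gen_eigen (ad h) a v -> exists z : int, a = z%:~R.
Proof.
move=> he [N eN] eW hW top vW v0 [M vM].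
have iter_mem (T : g -> g) n u :
    (forall u, u \in W -> T u \in W) -> u \in W -> iter n T u \in W.
  by move=> TW uW; elim: n => //= n IH; apply: TW.
have [|j u0 hu] := @iter_last _ (eigen_shift (ad h) a) (pred1 0) M v v0.
  by rewrite /= vM.
set u := iter j _ v in u0 hu.
have uW : u \in W.
  by apply: iter_mem => // z zW; apply: stable_shift => // y yW; rewrite adE hW.
have {}hu : [lie h, u] = a *: u.
  by move: hu; rewrite /= eigen_shiftE adE subr_eq0 => /eqP.
have [|l t0 et] := @iter_last _ (lie e) (pred1 0) N u u0.
  by rewrite /= eN.
have ht n : [lie h, iter n (lie e) u] = (a + (2 * n)%:R) *: iter n (lie e) u.
  elim: n => [|n IH]; first by rewrite muln0 addr0.
  rewrite iterS lie_leibniz he lie_scalel IH linearZ /= -scalerDl.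
  by rewrite mulnS natrD addrCA.
have [||i aE] := top _ _ _ t0 _ (ht l); [exact: iter_mem|exact/eqP|].
exists (w i - (2 * l)%:Z); rewrite rmorphB /= -aE.
by rewrite -pmulrn addrK.
Qed.

End Weights.

(** * The transverse Poisson structure of the slice *)

Section Slice.
Variables (C : numClosedFieldType) (g : lieAlgType C).
Implicit Types (y z u v : g) (U V W : {vspace g}).
Variables (x s e h : g) (n_e : {vspace g}).
Variables (k : nat) (Z : k.-tuple g) (w : 'I_k -> nat).
Hypothesis nondeg : forall x : g, (forall y, killing x y = 0) -> x = 0.
Hypothesis x_dec : jordan_chevalley x s e.
Hypothesis he : [lie h, e] = 2 *: e.
Hypothesis sh0 : [lie s, h] = 0.
Hypothesis n_eP : calN s h x n_e.
Hypothesis Z_basis : basis_of (centralizer x) Z.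
Hypothesis Z_weight : forall i, [lie h, tnth Z i] = (w i)%:R *: tnth Z i.

Let gs := centralizer s.
Let n := (kperp gs + n_e)%VS.

Let xE : x = s + e. Proof. by case: x_dec. Qed.
Let s_ss : semisimple_elt s. Proof. by case: x_dec. Qed.
Let e_nil : ad_nilpotent e. Proof. by case: x_dec. Qed.
Let se0 : [lie s, e] = 0. Proof. by case: x_dec. Qed.
Let n_e_gs : (n_e <= gs)%VS. Proof. by case: n_eP. Qed.
Let s_gs : s \in gs. Proof. by rewrite mem_centralizer liexx. Qed.
Let e_gs : e \in gs. Proof. by rewrite mem_centralizer se0. Qed.
Let h_gs : h \in gs. Proof. by rewrite mem_centralizer sh0. Qed.
Let x_gs : x \in gs. Proof. by rewrite xE memvD. Qed.
Let gx_gs : (centralizer x <= gs)%VS.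
Proof. by rewrite (jordan_centralizer x_dec) capvSl. Qed.
Let n_e_sub_n : (n_e <= n)%VS. Proof. exact: addvSr. Qed.

Let gs_lie u v : u \in gs -> v \in gs -> [lie u, v] \in gs.
Proof. exact: centralizer_lie. Qed.

Let n_e_h v : v \in n_e -> [lie h, v] \in n_e.
Proof.
case: n_eP => _ /subvP hn _ _ vn; rewrite -adE; apply: hn.
exact: memv_img.
Qed.

Lemma directv_complements : directv (kperp gs + n_e).
Proof.
apply/directv_addP/eqP; rewrite -subv0.
rewrite -(semisimple_centralizer_cap nondeg s_ss) capvC.
by rewrite capvS.
Qed.

Let n_gx_cap : (n :&: centralizer x = 0)%VS.
Proof.
apply/eqP; rewrite -subv0; apply/subvP => u /memv_capP[].
case/memv_addP => a an [b bn ->] ab_x; case: n_eP => _ _ _ /directv_addP cap0.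
have a0 : a = 0.
  apply/eqP; rewrite -memv0 -(semisimple_centralizer_cap nondeg s_ss).
  rewrite memv_cap an andbT -[a](addrK b).
  by rewrite memvB //; [apply: (subvP gx_gs)|apply: (subvP n_e_gs)].
by move: ab_x; rewrite a0 add0r => bx; rewrite -cap0 memv_cap bn.
Qed.

Let n_gx_sum : (n + centralizer x)%VS = {:g}%VS.
Proof.
case: n_eP => _ _ sumE _.
by rewrite -addvA sumE semisimple_centralizer_sum.
Qed.

Lemma slice_transverse : directv (orbit_tangent x + kperp n)
  /\ (orbit_tangent x + kperp n)%VS = {:g}%VS.
Proof.
have [cap0 sum1] := kperp_compl nondeg n_gx_cap n_gx_sum.
rewrite (orbit_tangentE nondeg); split; last by rewrite addvC.
by apply/directv_addP; rewrite capvC.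
Qed.

Let base_nondeg u : u \in n ->
  (forall v, v \in n -> killing x [lie u, v] = 0) -> u = 0.
Proof.
move=> un un0; suff xu : [lie x, u] = 0.
  by apply/eqP; rewrite -memv0 -n_gx_cap memv_cap un mem_centralizer xu eqxx.
apply: nondeg => v; rewrite killing_lie.
have : v \in (n + centralizer x)%VS by rewrite n_gx_sum memvf.
case/memv_addP => a an [b bx ->]; rewrite !linearD /= un0 // add0r.
rewrite [ [lie u, b] ]lieC linearN /= -killing_lie.
by move: bx; rewrite mem_centralizer => /eqP ->; rewrite killingC linear0 oppr0.
Qed.

Lemma poisson_unit_base m (X : m.-tuple g) : basis_of n X ->
  lie_poisson_mx X X x \in unitmx.
Proof.
by move=> X_basis; apply: lie_poisson_unit X_basis _; apply: base_nondeg.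
Qed.

Let decouple y u v : y \in gs -> u \in gs -> v \in kperp gs ->
  killing y [lie u, v] = 0.
Proof.
by move=> ygs ugs; rewrite -killing_lie; apply: killing_perp_mem; apply: gs_lie.
Qed.

Let extend y u : y \in gs -> u \in gs ->
  (forall v, v \in n_e -> killing y [lie u, v] = 0) ->
  forall v, v \in n -> killing y [lie u, v] = 0.
Proof.
move=> ygs ugs H _ /memv_addP[a an [b bn ->]].
by rewrite !linearD /= decouple // H // addr0.
Qed.

Lemma poisson_unit_base_e m (X : m.-tuple g) : basis_of n_e X ->
  lie_poisson_mx X X x \in unitmx.
Proof.
move=> X_basis; apply: lie_poisson_unit X_basis _ => u un H.
apply: base_nondeg; first exact: (subvP n_e_sub_n).
by apply: extend => //; apply: (subvP n_e_gs).
Qed.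

Let Z_gs i : tnth Z i \in gs.
Proof. exact: (subvP gx_gs) (mem_basis i Z_basis). Qed.

(** The correcting vector u found in n_e also works for n, because the brackets
    at y of g(s) with its orthogonal vanish. *)
Lemma transverse_poisson_reduce y m (X : m.-tuple g) m' (X' : m'.-tuple g) i j :
  y \in gs -> basis_of n X -> basis_of n_e X' ->
  lie_poisson_mx X X y \in unitmx -> lie_poisson_mx X' X' y \in unitmx ->
  transverse_poisson_mx Z X y i j = transverse_poisson_mx Z X' y i j.
Proof.
move=> ygs X_basis X'_basis Cu Cu'.
have [u un uE] := dirac_correction Z i X'_basis Cu'.
rewrite (transverse_poisson_mxE j X'_basis Cu' un uE).
apply: (transverse_poisson_mxE j X_basis Cu (subvP n_e_sub_n _ un)).
by apply: extend => //; rewrite memvB // (subvP n_e_gs).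
Qed.

Let kperp_n_gs : (kperp n <= gs)%VS.
Proof.
apply/subvP => y /kperpP yn; rewrite -(kperpK nondeg gs).
by apply/kperpP => u un; apply: yn; apply: (subvP (addvSl _ _)).
Qed.

Let dim_kperp_n : \dim (kperp n) = k.
Proof.
have := dim_kperp nondeg n; rewrite -n_gx_sum dimv_disjoint_sum //.
by rewrite addnC => /addnI ->; rewrite (size_basis Z_basis).
Qed.

Let kperp_n_gx : (kperp n :&: kperp (centralizer x) = 0)%VS.
Proof. by have [] := kperp_compl nondeg n_gx_cap n_gx_sum. Qed.

(** [h, Zd i] + w_i Zd i lies in kperp n, which is stable under ad h as n is,
    and is orthogonal to every Z_j by invariance; the two orthogonals meet
    in 0. *)
Lemma slice_dual_basis : exists Zd : 'I_k -> g,
  [/\ forall i, Zd i \in kperp n,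
      forall i j, killing (Zd i) (tnth Z j) = (i == j)%:R
    & forall i, [lie h, Zd i] = - (w i)%:R *: Zd i].
Proof.
have [Zd [Zdn ZdE]] := killing_dual_basis Z_basis dim_kperp_n kperp_n_gx.
exists Zd; split=> // i; apply/eqP; rewrite scaleNr -addr_eq0.
rewrite -memv0 -kperp_n_gx memv_cap; apply/andP; split.
  rewrite memvD ?memvZ //; apply/kperpP => u un.
  rewrite -killing_lie lieC -scaleN1r killing_scalel.
  rewrite (killing_perp_mem _ (Zdn i)) ?mulr0 //.
  case/memv_addP: un => a an [b bn ->]; rewrite linearD memv_add ?n_e_h //.
  apply/kperpP => v vgs; rewrite -killing_lie (killing_perp_mem _ an) //.
  exact: gs_lie.
apply/kperpP => u ux.
rewrite (basis_sum Z_basis ux) killing_suml big1 // => j _.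
rewrite killing_scalel killingC killing_addl killing_scalel.
rewrite lieC -scaleN1r killing_scalel killing_lie Z_weight.
rewrite [killing (Zd i) (_ *: _)]killingC killing_scalel killingC ZdE.
have [->|] := eqVneq i j; first by rewrite !mulr1 mulN1r addNr mulr0.
by rewrite !mulr0 addr0 mulr0.
Qed.

Section Coordinates.
Variable Zd : 'I_k -> g.
Hypothesis Zd_n : forall i, Zd i \in kperp n.
Hypothesis ZdE : forall i j, killing (Zd i) (tnth Z j) = (i == j)%:R.
Hypothesis Zd_weight : forall i, [lie h, Zd i] = - (w i)%:R *: Zd i.

Definition slice_point (q : 'I_k -> C) : g := x + \sum_i q i *: Zd i.

Lemma slice_point_gs q : slice_point q \in gs.
Proof.
by rewrite memvD // memv_suml // => i _; rewrite memvZ // (subvP kperp_n_gs).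
Qed.

Lemma slice_coordK y : y \in slice x n -> slice_point (slice_coord x Z y) = y.
Proof.
rewrite inE => yn; apply/eqP; rewrite eq_sym -subr_eq0 opprD addrA.
rewrite -memv0 -kperp_n_gx memv_cap; apply/andP; split.
  by rewrite memvB // memv_suml // => i _; rewrite memvZ.
apply/kperpP => u ux.
rewrite (basis_sum Z_basis ux) killing_suml big1 // => j _.
rewrite killing_scalel killingC killing_subl killing_suml (bigD1 j) //=.
rewrite big1 => [|i ij].
  by rewrite killing_scalel ZdE eqxx mulr1 addr0 subrr mulr0.
by rewrite killing_scalel ZdE (negPf ij) mulr0.
Qed.

Definition dilate (t : C) (q : 'I_k -> C) : 'I_k -> C :=
  fun i => t ^+ (w i + 2) * q i.

(** The summand s of a point of the slice, which dilations do not scale, drops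
    out: <s|[u,v]> = <[s,u]|v> = 0 for u in g(s). *)
Lemma slice_bracket_dilate (t : C) q (a b : int) u v : t != 0 ->
  u \in gs -> v \in gs ->
  gen_eigen (ad h) a%:~R u -> gen_eigen (ad h) b%:~R v ->
  killing (slice_point (dilate t q)) [lie u, v]
  = t ^ (a + b + 2) * killing (slice_point q) [lie u, v].
Proof.
move=> t0 ugs vgs ua vb.
have uv := gen_eigen_lie (ad_derivation h) ua vb.
have s0 : killing s [lie u, v] = 0.
  rewrite -killing_lie; move: ugs; rewrite mem_centralizer => /eqP ->.
  by rewrite killingC linear0.
(* A nonzero pairing forces opposite weights: a + b = - 2 for e, a + b = w i
   for Zd i. *)
have e0 : killing e [lie u, v] = t ^ (a + b + 2) * killing e [lie u, v].
  have [->|ab] := eqVneq (a + b + 2) 0; first by rewrite expr0z mul1r.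
  rewrite (killing_weight_eq0 he uv) ?mulr0 //.
  have -> : 2 + (a%:~R + b%:~R) = (a + b + 2)%:~R :> C.
    by rewrite !rmorphD addrC.
  by rewrite intr_eq0.
have Zd0 i : t ^+ (w i + 2) * killing (Zd i) [lie u, v]
    = t ^ (a + b + 2) * killing (Zd i) [lie u, v].
  have [->|ab] := eqVneq (a + b) (w i)%:Z; first by rewrite -PoszD exprnP.
  rewrite (killing_weight_eq0 (Zd_weight i) uv) ?mulr0 //.
  have -> : - (w i)%:R + (a%:~R + b%:~R) = (a + b - (w i)%:Z)%:~R :> C.
    by rewrite rmorphB rmorphD addrC.
  by rewrite intr_eq0 subr_eq0.
rewrite /slice_point xE !killing_addl s0 !add0r mulrDr -e0; congr (_ + _).
rewrite !killing_suml mulr_sumr; apply: eq_bigr => i _.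
by rewrite !killing_scalel mulrCA -Zd0 /dilate; ring.
Qed.

Variables (m : nat) (X : m.-tuple g) (a : 'I_m -> int).
Hypothesis X_basis : basis_of n_e X.
Hypothesis X_weight : forall l, gen_eigen (ad h) (a l)%:~R (tnth X l).

(** The Lie-Poisson bracket of u and v on the slice, an affine function of the
    coordinates. *)
Definition bracket_poly (u v : g) : {mpoly C[k]} :=
  (killing x [lie u, v])%:MP + \sum_i killing (Zd i) [lie u, v] *: 'X_i.

Definition bracket_poly_mx p r (U : p.-tuple g) (V : r.-tuple g) :=
  \matrix_(i, j) bracket_poly (tnth U i) (tnth V j).

Lemma bracket_poly_eval p r (U : p.-tuple g) (V : r.-tuple g) q :
  map_mx (meval q) (bracket_poly_mx U V) = lie_poisson_mx U V (slice_point q).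
Proof.
apply/matrixP => i j; rewrite !mxE mevalD mevalC killing_addl; congr (_ + _).
rewrite linear_sum killing_suml; apply: eq_bigr => l _ /=.
by rewrite mevalZ mevalXU killing_scalel mulrC.
Qed.

Let X_gs l : tnth X l \in gs.
Proof. exact: (subvP n_e_gs) (mem_basis l X_basis). Qed.

Let Z_gen i : gen_eigen (ad h) (w i)%:Z%:~R (tnth Z i).
Proof. by apply: eigen_gen_eigen; rewrite adE Z_weight. Qed.

(* The shift by 1 on each side distributes the exponent 2 of
   slice_bracket_dilate evenly over rows and columns. *)
Let N (t : C) : 'M[C]_k := diag_mx (\row_i t ^+ (w i + 1)).
Let D (t : C) : 'M[C]_m := diag_mx (\row_l t ^ (a l + 1)).

Lemma diag_congr_mxE p r (dl : 'I_p -> C) (dr : 'I_r -> C)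
    (M : 'M[C]_(p, r)) i j :
  (diag_mx (\row_i dl i) *m M *m diag_mx (\row_j dr j)) i j
  = dl i * M i j * dr j.
Proof. by rewrite mul_mx_diag mxE mul_diag_mx !mxE. Qed.

Lemma dilate_ZZ t q : t != 0 ->
  lie_poisson_mx Z Z (slice_point (dilate t q))
  = N t *m lie_poisson_mx Z Z (slice_point q) *m N t.
Proof.
move=> t0; apply/matrixP => i j; rewrite diag_congr_mxE !mxE.
rewrite (slice_bracket_dilate q t0 (Z_gs i) (Z_gs j) (Z_gen i) (Z_gen j)).
have -> : (w i)%:Z + (w j)%:Z + 2 = (w i + 1 + (w j + 1))%N :> int by lia.
by rewrite -exprnP exprD; ring.
Qed.

Lemma dilate_ZX t q : t != 0 ->
  lie_poisson_mx Z X (slice_point (dilate t q))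
  = N t *m lie_poisson_mx Z X (slice_point q) *m D t.
Proof.
move=> t0; apply/matrixP => i j; rewrite diag_congr_mxE !mxE.
rewrite (slice_bracket_dilate q t0 (Z_gs i) (X_gs j) (Z_gen i) (X_weight j)).
have -> : (w i)%:Z + a j + 2 = (w i + 1)%N%:Z + (a j + 1) by lia.
by rewrite expfzDr // -exprnP; ring.
Qed.

Lemma dilate_XX t q : t != 0 ->
  lie_poisson_mx X X (slice_point (dilate t q))
  = D t *m lie_poisson_mx X X (slice_point q) *m D t.
Proof.
move=> t0; apply/matrixP => i j; rewrite diag_congr_mxE !mxE.
rewrite (slice_bracket_dilate q t0 (X_gs i) (X_gs j) (X_weight i) (X_weight j)).
have -> : a i + a j + 2 = (a i + 1) + (a j + 1) by lia.
by rewrite expfzDr //; ring.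
Qed.

Let D_unit t : t != 0 -> D t \in unitmx.
Proof.
move=> t0; rewrite unitmxE det_diag unitfE; apply/prodf_neq0 => l _.
by rewrite mxE expfz_neq0.
Qed.

Let det_poly := \det (bracket_poly_mx X X).
Let c := \det (lie_poisson_mx X X x).

Let c_neq0 : c != 0.
Proof. by rewrite -unitfE -unitmxE poisson_unit_base_e. Qed.

Let slice_point0 : slice_point (fun=> 0) = x.
Proof. by rewrite /slice_point big1 ?addr0 // => i _; rewrite scale0r. Qed.

Let det_polyE q : det_poly.@[q] = \det (lie_poisson_mx X X (slice_point q)).
Proof. by rewrite -det_map_mx bracket_poly_eval. Qed.

Lemma det_poisson_const q : \det (lie_poisson_mx X X (slice_point q)) = c.
Proof.
have detE t q' : t != 0 ->
    det_poly.@[dilate t q'] = \det (D t) ^+ 2 * det_poly.@[q'].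
  by move=> t0; rewrite !det_polyE dilate_XX // !det_mulmx; ring.
have dil0 t : dilate t (fun=> 0) =1 (fun=> 0).
  by move=> i; rewrite /dilate mulr0.
have det0 : det_poly.@[fun=> 0] = c by rewrite det_polyE slice_point0.
rewrite -det0 -det_polyE.
apply: (@mpoly_scaling_invariant _ _ (fun i => w i + 2)%N) => [i|t t0 q'].
  by rewrite addnC.
have := detE t (fun=> 0) t0; rewrite (meval_eq _ (dil0 t)) det0 => cE.
(* The origin is fixed by dilations and the determinant there is c != 0. *)
have D1 : \det (D t) ^+ 2 = 1 by apply: (mulIf c_neq0); rewrite mul1r -cE.
by rewrite -/(dilate t q') detE // D1 mul1r.
Qed.

Let C_unit q : lie_poisson_mx X X (slice_point q) \in unitmx.
Proof. by rewrite unitmxE det_poisson_const unitfE c_neq0. Qed.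

Definition transverse_poly_mx : 'M[{mpoly C[k]}]_k :=
  bracket_poly_mx Z Z
  + bracket_poly_mx Z X *m (c^-1%:MP *: \adj (bracket_poly_mx X X))
    *m (bracket_poly_mx Z X)^T.

Lemma transverse_poly_eval q i j :
  (transverse_poly_mx i j).@[q] = transverse_poisson_mx Z X (slice_point q) i j.
Proof.
suff <- : map_mx (meval q) transverse_poly_mx
          = transverse_poisson_mx Z X (slice_point q) by rewrite [RHS]mxE.
rewrite map_mxD !map_mxM map_mxZ map_mx_adj -map_trmx !bracket_poly_eval.
rewrite /= mevalC.
by rewrite /transverse_poisson_mx /invmx C_unit det_poisson_const.
Qed.

Lemma transverse_poly_quasi_homogeneous :
  quasi_homogeneous_poisson (fun i => (w i + 2)%N) (- 2) transverse_poly_mx.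
Proof.
move=> i j t t0 q; rewrite -/(dilate t q) !transverse_poly_eval.
rewrite /transverse_poisson_mx dilate_ZZ // dilate_ZX // dilate_XX //.
rewrite dirac_reduction_congr ?tr_diag_mx ?D_unit //.
rewrite diag_congr_mxE.
have -> : (w i + 2)%N%:Z + (w j + 2)%N%:Z + - 2
          = (w i + 1 + (w j + 1))%N :> int by lia.
by rewrite -exprnP [t ^+ (_ + (_ + _))]exprD mulrAC.
Qed.

End Coordinates.

(** A vector of g(s) killed by e lies in g(x), so its weight is one of the
    w_i. *)
Lemma weight_basis :
  exists (a : 'I_(\dim n_e) -> int) (X : (\dim n_e).-tuple g), basis_of n_e X
  /\ forall l, gen_eigen (ad h) (a l)%:~R (tnth X l).
Proof.
have [|X X_basis X_gen] := @gen_eigen_basis _ _ (ad h) n_e.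
  by move=> v vn; rewrite adE n_e_h.
have [a aE] : exists a : 'I_(\dim n_e) -> int,
    forall l, gen_eigen (ad h) (a l)%:~R (tnth X l).
  apply: (@fin_all_exists _ (fun=> int)
    (fun l (b : int) => gen_eigen (ad h) b%:~R (tnth X l))) => l.
  have [b bE] := X_gen l.
  suff [z zE] : exists z : int, b = z%:~R by exists z; rewrite -zE.
  apply: (@gen_weight_integral _ _ h e gs _ (fun i => (w i)%:Z) b (tnth X l))
    => //.
  - by move=> u ugs; apply: gs_lie.
  - by move=> u ugs; apply: gs_lie.
  - move=> u d ugs u0 eu hu.
    have ux : u \in centralizer x.
      rewrite (jordan_centralizer x_dec) memv_cap ugs mem_centralizer.
      by rewrite eu eqxx.
    have uE := basis_sum Z_basis ux.
    have [i ci] : exists i, coord Z i u != 0.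
      apply/existsP; apply: contraNT u0; rewrite negb_exists => /forallP c0.
      rewrite uE big1 // => i _; move: (c0 i); rewrite negbK => /eqP ->.
      by rewrite scale0r.
    exists i; apply/eqP; rewrite -subr_eq0.
    have := free_sum_eq0 (c := fun i => coord Z i u * (d - (w i)%:Z%:~R))
      (basis_free Z_basis).
    move=> /(_ _ i); rewrite -(inj_eq (mulfI ci)) mulr0.
    move=> ->; first exact: eqxx.
    have huE : [lie h, u] = \sum_l' (coord Z l' u * (w l')%:R) *: tnth Z l'.
      rewrite {1}uE linear_sum; apply: eq_bigr => l' _ /=.
      by rewrite linearZ /= Z_weight scalerA.
    transitivity (d *: u - [lie h, u]); last by rewrite hu subrr.
    have -> : d *: u = \sum_l' (coord Z l' u * d) *: tnth Z l'.
      rewrite {1}uE scaler_sumr; apply: eq_bigr => l' _.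
      by rewrite scalerA mulrC.
    by rewrite huE -sumrB; apply: eq_bigr => l' _; rewrite -scalerBl -mulrBr.
  - exact: (subvP n_e_gs) (mem_basis l X_basis).
  - by apply: (free_not0 (basis_free X_basis)); apply: mem_tnth.
by exists a, X.
Qed.

Theorem slice_poisson_quasi_homogeneous m (X : m.-tuple g) : basis_of n X ->
  exists P : 'M[{mpoly C[k]}]_k,
    (forall y, y \in slice x n -> lie_poisson_mx X X y \in unitmx ->
       forall i j, transverse_poisson_mx Z X y i j
                   = (P i j).@[slice_coord x Z y])
    /\ quasi_homogeneous_poisson (fun i => (w i + 2)%N) (- 2) P.
Proof.
move=> X_basis; have [Zd [Zdn ZdE Zdw]] := slice_dual_basis.
have [a [X' [X'_basis X'_gen]]] := weight_basis.
exists (transverse_poly_mx Zd X'); split.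
  move=> y yn Cu i j.
  rewrite (transverse_poly_eval Zdw X'_basis X'_gen).
  have yE := slice_coordK Zdn ZdE yn; rewrite yE.
  apply: transverse_poisson_reduce => //.
    by rewrite -yE slice_point_gs.
  rewrite -yE unitmxE (det_poisson_const Zdw X'_basis X'_gen) -unitmxE.
  exact: poisson_unit_base_e.
exact: (transverse_poly_quasi_homogeneous Zdw X'_basis X'_gen).
Qed.

End Slice.

Local Open Scope complex_scope.

Theorem corollary3p4 (R : realType) (g : lieAlgType R[i])
    (g_semisimple : semisimple_lie g)
    (x s e h f : g)
    (x_dec : jordan_chevalley x s e)
    (hef : sl2_triple h e f)
    (sh0 : [lie s, h] = 0) (sf0 : [lie s, f] = 0)
    (n_s n_e n : {vspace g})
    (n_sE : n_s = kperp (centralizer s))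
    (n_eP : calN s h x n_e)
    (nE : n = (n_s + n_e)%VS)
    (k : nat) (Z : k.-tuple g) (w : 'I_k -> nat)
    (Z_basis : basis_of (centralizer x) Z)
    (Z_hw : forall i, highest_weight_vector h e (w i) (tnth Z i))
    (m : nat) (X : m.-tuple g) (X_basis : basis_of n X) :
  [/\ directv (n_s + n_e),
      directv (orbit_tangent x + kperp n)
        /\ (orbit_tangent x + kperp n)%VS = {:g}%VS,
      lie_poisson_mx X X x \in unitmx
    & exists P : 'M[{mpoly R[i][k]}]_k,
        (forall y, y \in slice x n -> lie_poisson_mx X X y \in unitmx ->
           forall i j, transverse_poisson_mx Z X y i j
                       = (P i j).@[slice_coord x Z y])
        /\ quasi_homogeneous_poisson (fun i => (w i + 2)%N) (- 2) P].
Proof.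
have nondeg := killing_nondegenerate g_semisimple.
have [he _ _] := hef.
have Z_weight i : [lie h, tnth Z i] = (w i)%:R *: tnth Z i.
  by case: (Z_hw i).
subst n_s n; split.
- exact: directv_complements nondeg x_dec n_eP.
- exact: slice_transverse nondeg x_dec n_eP.
- exact: poisson_unit_base nondeg x_dec n_eP _ _ X_basis.
- exact: (slice_poisson_quasi_homogeneous nondeg x_dec he sh0 n_eP
            Z_basis Z_weight X_basis).
Qed.
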